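(* Let $p$ be a prime, let $n,d$ be positive integers, let $\delta\in(0,1]$ be a distance parameter, and let $t\leq \frac{\delta}{30}p^{n/(20d)}$. Then there is a $t$-online-corruption-resilient tester for degree $d$ for functions $f:\mathbb{F}_p^n\to\mathbb{F}_p$ with query complexity $O\!\left(\frac{(\log(t/\delta))^{3d+3}}{\delta}\right)$, satisfying: (Completeness) if $f$ has degree at most $d$, the tester accepts with probability at least $2/3$; (Soundness) if $f$ is $\delta$-far from degree $d$, the tester rejects with probability at least $2/3$.
   Context: Every function $f:\mathbb{F}_q^n\to\mathbb{F}_q$ has a unique polynomial representation $f(x)=\sum_{e\in\{0,\dots,q-1\}^n} C_e x^e$ with $x^e=\prod_i x_i^{e_i}$; its degree is $\max\{|e|_1 : C_e\neq 0\}$. For $f,g$ on $\mathbb{F}_q^n$, $\delta(f,g)=\Pr_{x\in\mathbb{F}_q^n}[f(x)\neq g(x)]$, and $f$ is $\delta$-far from degree $d$ if $\min_{g:\deg g\le d}\delta(f,g)\geq\delta$. The $t$-online-corruption model: a (randomized, adaptive) tester has query access to $f$; the tester queries points one at a time, and after each query an adversary (who may know all queries so far) may change the values of any $t$ entries of the truth table of $f$. A query returns the current (possibly modified) value at that point, with no indication of whether it was modified. A tester is $t$-online-corruption-resilient if its completeness and soundness guarantees hold against every such adversary, where ''$f$ has degree at most $d$'' / ''$f$ is $\delta$-far'' refer to the original input function. *)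

(* Defs.v *)
From HB Require Import structures.
From mathcomp Require Import all_boot all_order all_algebra.
From mathcomp Require Import reals exp.
Set Implicit Arguments. Unset Strict Implicit. Unset Printing Implicit Defensive.
Import Order.TTheory GRing.Theory Num.Theory.
Local Open Scope ring_scope.

Definition point (p n : nat) := {ffun 'I_n -> 'F_p}.

Definition monomial (p n : nat) (e : {ffun 'I_n -> 'I_p}) (x : point p n) : 'F_p :=
  \prod_(i < n) (x i) ^+ (e i).

(* f has degree at most d: its (unique) polynomial representation
   f = sum_e C_e x^e (e in {0..p-1}^n) has C_e = 0 whenever |e|_1 > d. *)
Definition deg_le (p n d : nat) (f : point p n -> 'F_p) : Prop :=
  exists C : {ffun 'I_n -> 'I_p} -> 'F_p,
    (forall e : {ffun 'I_n -> 'I_p}, (d < \sum_(i < n) (e i : nat))%N -> C e = 0) /\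
    (forall x, f x = \sum_(m : {ffun 'I_n -> 'I_p}) C m * monomial m x).

Definition dist (R : realType) (T : finType) (V : eqType) (f g : T -> V) : R :=
  (#|[pred x : T | f x != g x]|)%:R / (#|T|)%:R.

Definition far_from_deg (R : realType) (p n d : nat) (delta : R)
    (f : point p n -> 'F_p) : Prop :=
  forall g : point p n -> 'F_p, deg_le d g -> delta <= dist R f g.

(* A deterministic adaptive adversary in the t-online-corruption model:
   adv s is the current truth table after the queries in s have been made
   (and the adversary has modified after each of them). Initially the table
   is f, and after each query at most t entries are changed. *)
Definition online_adversary (T : finType) (V : eqType) (t : nat)
    (f : T -> V) (adv : seq T -> T -> V) : Prop :=
  adv [::] =1 f /\
  forall (s : seq T) (x : T), (#|[pred y | adv (rcons s x) y != adv s y]| <= t)%N.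

(* Run of an adaptive tester (for a fixed random seed): the next query is
   chosen from the answers so far; the answer to a query x made after the
   queries qs is the current value adv qs x. Returns (queries, answers). *)
Fixpoint run (T : finType) (V : eqType) (qry : seq V -> T)
    (adv : seq T -> T -> V) (k : nat) : seq T * seq V :=
  match k with
  | 0 => ([::], [::])
  | k'.+1 =>
      let: (qs, ans) := run qry adv k' in
      let x := qry ans in (rcons qs x, rcons ans (adv qs x))
  end.

Definition accept_prob (R : realType) (Rnd T : finType) (V : eqType)
    (q : nat) (qry : Rnd -> seq V -> T) (dec : Rnd -> seq V -> bool)
    (adv : seq T -> T -> V) : R :=
  (#|[pred r : Rnd | dec r (run (qry r) adv q).2]|)%:R / (#|Rnd|)%:R.

(* Main.v *)
Require Import Defs.
From HB Require Import structures.
From mathcomp Require Import all_boot all_order all_algebra finfield.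
From mathcomp Require Import ring lra zify.
From mathcomp Require Import boolp reals sequences exp.
Set Implicit Arguments. Unset Strict Implicit. Unset Printing Implicit Defensive.
Import Order.TTheory GRing.Theory Num.Theory.
Local Open Scope ring_scope.

(** A function has degree at most [d] iff all its [d.+1]-fold finite differences
vanish, and a function [delta]-far from degree [d] has a nonzero random
[d.+1]-fold difference with probability [>= delta / 4 ^ d.+2]: otherwise the
plurality vote of the values predicted by the other vertices of random cubes is
a close function with vanishing differences.

The tester pulls [f] back along a random affine map from [F_p^m], with [m] of
order [log (t / delta)], queries the pullback at independent uniform points, one
more than what determines a polynomial of degree [d], and checks consistency with
such a polynomial; this is repeated [O(1 / delta)] times.  Every query is nearly
uniform on a set of [p^m >> t q^2] points even given all earlier queries, so with
high probability no corrupted value is ever read.  If [n < m], the points are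
sampled in [F_p^n] itself, where a union bound over all polynomials suffices. *)

(** The derivative test does not survive online corruption: the last vertex of a cube is determined
    by the others, so it can be corrupted before it is read. Hence cubes occur only in the analysis,
    while the queries are independent points. Such points reveal an excess of degree only by
    overdetermining a polynomial, which takes a number of samples governed by the number of
    monomials: of order [n ^ d] on the whole space, but of order [m ^ d] after the pullback. In the
    other direction [m] has to be logarithmic, because the sampled set must be large compared with
    the up to [t * q] points that can be corrupted. The hypothesis on [t] enters when [n < m], where
    it makes [p ^ n] large compared with [t * q ^ 2]. The error 1/3 is split evenly: 1/6 for reading
    a corrupted value, 1/6 for accepting a far function on honest answers. *)

HB.instance Definition _ (I : finType) (V : finZmodType) :=
  GRing.Zmodule.on {ffun I -> V}.

(** * Averages over finite types *)

Section Average.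
Context {R : realType}.
Implicit Types T U : finType.

Definition avg T (F : T -> R) : R := (\sum_x F x) / #|T|%:R.

Lemma eq_avg T (F G : T -> R) : F =1 G -> avg F = avg G.
Proof. by move=> eqFG; rewrite /avg (eq_bigr _ (fun x _ => eqFG x)). Qed.

Lemma le_avg T (F G : T -> R) : (forall x, F x <= G x) -> avg F <= avg G.
Proof.
by move=> leFG; rewrite /avg ler_wpM2r ?invr_ge0 ?ler0n// ler_sum.
Qed.

Lemma avg_ge0 T (F : T -> R) : (forall x, 0 <= F x) -> 0 <= avg F.
Proof. by move=> F0; rewrite /avg divr_ge0 ?ler0n ?sumr_ge0. Qed.

Lemma avgD T (F G : T -> R) : avg (fun x => F x + G x) = avg F + avg G.
Proof. by rewrite /avg big_split mulrDl. Qed.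

Lemma avgZ T c (F : T -> R) : avg (fun x => c * F x) = c * avg F.
Proof. by rewrite /avg -mulr_sumr mulrA. Qed.

Lemma avg_sum T (I : Type) (r : seq I) (P : pred I) (F : I -> T -> R) :
  avg (fun x => \sum_(i <- r | P i) F i x) = \sum_(i <- r | P i) avg (F i).
Proof. by rewrite /avg exchange_big mulr_suml. Qed.

Lemma avg_cst T (x0 : T) (c : R) : avg (fun _ : T => c) = c.
Proof.
rewrite /avg sumr_const -[c *+ _]mulr_natr mulfK// pnatr_eq0 -lt0n.
by apply/card_gt0P; exists x0.
Qed.

Lemma avg_le T (x0 : T) (F : T -> R) c : (forall x, F x <= c) -> avg F <= c.
Proof. by move=> Fc; rewrite -[leRHS](avg_cst x0); apply: le_avg. Qed.

Lemma exchange_avg T U (F : T -> U -> R) :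
  avg (fun x => avg (F x)) = avg (fun y => avg (F^~ y)).
Proof.
rewrite /avg -!mulr_suml exchange_big /=.
by rewrite -!mulrA; congr (_ * _); rewrite mulrC.
Qed.

Lemma reindex_avg T U (h : T -> U) (F : U -> R) :
  bijective h -> avg (fun x => F (h x)) = avg F.
Proof.
move=> bh; rewrite /avg (bij_eq_card bh); congr (_ / _).
by rewrite [RHS](reindex h)//; apply: onW_bij.
Qed.

Lemma avg_pair T U (F : T * U -> R) :
  avg F = avg (fun x => avg (fun y => F (x, y))).
Proof.
rewrite /avg card_prod natrM invfM -mulr_suml pair_bigA /=.
rewrite mulrA mulrAC; congr (_ / _ / _).
by apply: eq_bigr => -[].
Qed.

Lemma avg_shift (V : finZmodType) (a : V) (F : V -> R) :
  avg (fun x => F (x + a)) = avg F.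
Proof. by apply: reindex_avg; exists (+%R^~ (- a)) => x; rewrite ?addrK ?addrNK. Qed.

Lemma avg_pred T (P : pred T) : avg (fun x => (P x)%:R) = #|P|%:R / #|T|%:R.
Proof.
by rewrite /avg -natr_sum -sum1_card [in RHS]big_mkcond.
Qed.

Lemma avg_predC T (x0 : T) (P : pred T) :
  avg (fun x => (~~ P x)%:R) = 1 - avg (fun x => (P x)%:R).
Proof.
apply/eqP; rewrite eq_sym subr_eq -avgD -[X in X == _](avg_cst x0 1).
by apply/eqP/eq_avg => x; case: (P x); rewrite ?add0r ?addr0.
Qed.

Lemma avg_mass T (x0 : T) (P : pred T) : avg (fun x => (P x)%:R) <= 1.
Proof. by apply: (avg_le x0) => x; case: (P x). Qed.

Lemma le_indic (a b : bool) : (a -> b) -> a%:R <= b%:R :> R.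
Proof. by case: a => [->|_]//; rewrite ler0n. Qed.

Lemma le_indicD (a b c : bool) : (a -> b || c) -> a%:R <= b%:R + c%:R :> R.
Proof.
case: a => [/(_ isT)|_]; last by rewrite addr_ge0 ?ler0n.
by case: b => /= [_|->]; rewrite ?lerDl ?lerDr ler0n.
Qed.

Lemma le_indic_has (I : Type) (s : seq I) (P : pred I) :
  (has P s)%:R <= \sum_(i <- s) (P i)%:R :> R.
Proof.
elim: s => [|i s IH]; first by rewrite big_nil.
by rewrite big_cons /=; apply: le_trans (lerD (lexx _) IH); apply: le_indicD.
Qed.

Lemma le_indic_exists (T : finType) (P : pred T) :
  [exists x, P x]%:R <= \sum_x (P x)%:R :> R.
Proof.
case: existsP => [[x Px]|_]; last exact: sumr_ge0.
by rewrite (bigD1 x)//= Px lerDl sumr_ge0.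
Qed.

Lemma prod_indic (I : finType) (P : pred I) :
  \prod_i (P i)%:R = [forall i, P i]%:R :> R.
Proof.
case: forallP => [H|/forallP]; first by rewrite big1// => i _; rewrite H.
by rewrite negb_forall => /existsP[i /negPf hi]; rewrite (bigD1 i)//= hi mul0r.
Qed.

(* Resampling one coordinate, seen through a lens [(get, upd)], does not change
   the uniform distribution: [(x, z) |-> (upd x z, get x)] is an involution. *)
Lemma avg_resample T U (get : T -> U) (upd : T -> U -> T) (F : T -> R) :
  (forall x z, get (upd x z) = z) ->
  (forall x z z', upd (upd x z) z' = upd x z') ->
  (forall x, upd x (get x) = x) ->
  avg F = avg (fun x => avg (fun z => F (upd x z))).
Proof.
move=> gu uu ug; case: (pickP U) => [u0 _|U0]; last first.
  have T0 : forall x : T, False by move=> x; have := U0 (get x).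
  by rewrite /avg !big1// => x; case: (T0 x).
rewrite -(avg_pair (fun xz => F (upd xz.1 xz.2))).
rewrite -(reindex_avg (h := fun xz : T * U => (upd xz.1 xz.2, get xz.1))
  (fun xz => F (upd xz.1 xz.2))).
  rewrite avg_pair /=; apply: eq_avg => x.
  by under eq_avg do rewrite uu ug; rewrite avg_cst.
by apply: inv_bij => -[x z] /=; rewrite uu ug gu.
Qed.

End Average.

(** * Averages over sequences of fixed length *)

Section IteratedAverage.
Context {R : realType} {T : finType} (x0 : T).
Implicit Types Phi Psi : seq T -> R.

(** Nested averages instead of one average over tuples: peeling off the head matches the recursion
    of [diffs] on its list of directions. *)
Fixpoint iavg (k : nat) Phi : R :=
  if k is k'.+1 then avg (fun v => iavg k' (fun s => Phi (v :: s))) else Phi [::].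

Lemma le_iavg k Phi Psi :
  (forall s, size s = k -> Phi s <= Psi s) -> iavg k Phi <= iavg k Psi.
Proof.
elim: k Phi Psi => [|k IH] Phi Psi le /=; first exact: le.
by apply: le_avg => v; apply: IH => s sk; apply: le; rewrite /= sk.
Qed.

Lemma eq_iavg k Phi Psi :
  (forall s, size s = k -> Phi s = Psi s) -> iavg k Phi = iavg k Psi.
Proof.
by move=> e; apply: le_anti; rewrite !le_iavg// => s /e ->.
Qed.

Lemma iavgD k Phi Psi : iavg k (fun s => Phi s + Psi s) = iavg k Phi + iavg k Psi.
Proof.
elim: k Phi Psi => [|k IH] Phi Psi //=.
by rewrite -avgD; apply: eq_avg => v; rewrite IH.
Qed.

Lemma iavgZ k c Phi : iavg k (fun s => c * Phi s) = c * iavg k Phi.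
Proof.
elim: k Phi => [|k IH] Phi //=.
by rewrite -avgZ; apply: eq_avg => v; rewrite IH.
Qed.

Lemma iavg_cst k c : iavg k (fun _ => c) = c.
Proof. by elim: k => //= k ->; rewrite (avg_cst x0). Qed.

Lemma iavg_sum k (I : Type) (r : seq I) (F : I -> seq T -> R) :
  iavg k (fun s => \sum_(i <- r) F i s) = \sum_(i <- r) iavg k (F i).
Proof.
elim: k F => [|k IH] F //=; rewrite -avg_sum.
by apply: eq_avg => v; rewrite IH.
Qed.

Lemma avg_iavg (U : finType) k (F : U -> seq T -> R) :
  avg (fun u => iavg k (F u)) = iavg k (fun s => avg (F^~ s)).
Proof.
elim: k F => [|k IH] F //=; rewrite exchange_avg.
by apply: eq_avg => v; rewrite IH.
Qed.

Lemma exchange_iavg k l (F : seq T -> seq T -> R) :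
  iavg k (fun s => iavg l (F s)) = iavg l (fun s' => iavg k (F^~ s')).
Proof.
elim: k F => [|k IH] F //=; rewrite -avg_iavg.
by apply: eq_avg => v; rewrite IH.
Qed.

Lemma iavg_rcons k Phi :
  iavg k.+1 Phi = iavg k (fun s => avg (fun v => Phi (rcons s v))).
Proof.
elim: k Phi => [|k IH] Phi //=.
by apply: eq_avg => v; have /= -> := IH (fun s => Phi (v :: s)).
Qed.

Lemma iavg_predC k (P : pred (seq T)) :
  iavg k (fun s => (~~ P s)%:R) = 1 - iavg k (fun s => (P s)%:R).
Proof.
apply/eqP; rewrite eq_sym subr_eq -iavgD -[X in X == _](iavg_cst k 1).
by apply/eqP/eq_iavg => s _; case: (P s); rewrite ?add0r ?addr0.
Qed.

End IteratedAverage.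

(** * Iterated finite differences and the derivative test *)

Section Differences.
Context {V : finZmodType} {K : fieldType}.
Implicit Types (f g : V -> K) (h : V) (hs : seq V).

Definition diff h f : V -> K := fun x => f (x + h) - f x.

Fixpoint diffs hs f : V -> K := if hs is h :: hs' then diff h (diffs hs' f) else f.

Definition vanish k f := forall hs, size hs = k -> forall x, diffs hs f x = 0.

(* [diffs] without the vertex [x] of the cube *)
Definition punct hs f x := diffs hs f x - (-1) ^+ size hs * f x.

Lemma eq_diffs hs f g : f =1 g -> diffs hs f =1 diffs hs g.
Proof. by move=> e; elim: hs => //= h hs IH x; rewrite /diff !IH. Qed.

Lemma diffs_shift hs f h x : diffs hs (fun y => f (y + h)) x = diffs hs f (x + h).
Proof. by elim: hs x => //= a hs IH x; rewrite /diff !IH addrAC. Qed.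

Lemma diffsB hs f g x : diffs hs (fun y => f y - g y) x = diffs hs f x - diffs hs g x.
Proof. by elim: hs x => //= a hs IH x; rewrite /diff !IH; ring. Qed.

Lemma diffsD hs f g x : diffs hs (fun y => f y + g y) x = diffs hs f x + diffs hs g x.
Proof. by elim: hs x => //= a hs IH x; rewrite /diff !IH; ring. Qed.

Lemma diffsZ hs c f x : diffs hs (fun y => c * f y) x = c * diffs hs f x.
Proof. by elim: hs x => //= a hs IH x; rewrite /diff !IH; ring. Qed.

Lemma diffsC hs hs' f x : diffs hs (diffs hs' f) x = diffs hs' (diffs hs f) x.
Proof.
elim: hs x => //= h hs IH x.
by rewrite /diff diffsB (diffs_shift _ (diffs hs f)) !IH.
Qed.

Lemma diffs_cons h hs f x : diffs (h :: hs) f x = diffs hs (diff h f) x.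
Proof. exact: (diffsC [:: h]). Qed.

Lemma diffs_cat s1 s2 f x : diffs (s1 ++ s2) f x = diffs s1 (diffs s2 f) x.
Proof. by elim: s1 x => //= h s1 IH x; rewrite /diff !IH. Qed.

Lemma punctB hs f g x : punct hs (fun y => f y - g y) x = punct hs f x - punct hs g x.
Proof. by rewrite /punct diffsB; ring. Qed.

Lemma punct_cons h hs f x : punct (h :: hs) f x = diffs hs f (x + h) - punct hs f x.
Proof. by rewrite /punct /= /diff exprS; ring. Qed.

Lemma vanishS k f : vanish k.+1 f <-> forall h, vanish k (diff h f).
Proof.
split=> [v h hs sk x|v [|h hs]//= [sk] x].
  by rewrite -diffs_cons v /= ?sk.
by have := v h hs sk x; rewrite -diffs_cons.
Qed.

Lemma eq_vanish k f g : f =1 g -> vanish k f -> vanish k g.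
Proof. by move=> e v hs sk x; rewrite -(eq_diffs hs e) v. Qed.

Lemma vanish_shift k f h : vanish k f -> vanish k (fun x => f (x + h)).
Proof. by move=> v hs sk x; rewrite diffs_shift v. Qed.

Lemma vanish_cst0 k : vanish k (fun _ => 0).
Proof. by move=> hs _ x; elim: hs x => //= h hs IH x; rewrite /diff !IH subrr. Qed.

Lemma vanishD k f g : vanish k f -> vanish k g -> vanish k (fun x => f x + g x).
Proof. by move=> vf vg hs sk x; rewrite diffsD vf// vg// addr0. Qed.

Lemma vanishB k f g : vanish k f -> vanish k g -> vanish k (fun x => f x - g x).
Proof. by move=> vf vg hs sk x; rewrite diffsB vf// vg// subr0. Qed.

Lemma vanishZ k c f : vanish k f -> vanish k (fun x => c * f x).
Proof. by move=> vf hs sk x; rewrite diffsZ vf// mulr0. Qed.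

Lemma vanish_sum k (I : Type) (r : seq I) (F : I -> V -> K) :
  (forall i, vanish k (F i)) -> vanish k (fun x => \sum_(i <- r) F i x).
Proof.
move=> v; elim: r => [|i r IH].
  by apply: eq_vanish (@vanish_cst0 k) => x; rewrite big_nil.
by apply: eq_vanish (vanishD (v i) IH) => x; rewrite big_cons.
Qed.

Lemma vanishW k l f : (k <= l)%N -> vanish k f -> vanish l f.
Proof.
move=> kl v hs sl x.
rewrite -(cat_take_drop (l - k) hs) diffs_cat (@eq_diffs _ _ (fun=> 0)).
  by rewrite (@vanish_cst0 (l - k))// size_take sl; case: ltnP => // h; lia.
by move=> y; rewrite v// size_drop sl subKn.
Qed.

(** Induction on [a + b] through the discrete Leibniz rule [diff h (f g) = diff h f * g (. + h) + f
    * diff h g]. When [a = 0] or [b = 0], that factor is constant and its term disappears. *)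
Lemma vanishM a b f g :
  vanish a.+1 f -> vanish b.+1 g -> vanish (a + b).+1 (fun x => f x * g x).
Proof.
elim: {a b}(a + b)%N {-2}a {-2}b (erefl (a + b)%N) f g => [|s IH] a b eab f g vf vg.
  have [? ?] : a = 0%N /\ b = 0%N by lia.
  subst a b.
  apply/vanishS => h [|//] _ x /=.
  have := vf [:: h] erefl x; have := vg [:: h] erefl x.
  by rewrite /= /diff => /subr0_eq -> /subr0_eq ->; rewrite subrr.
apply/vanishS => h; rewrite eab.
apply: (@eq_vanish _ (fun x => diff h f x * g (x + h) + f x * diff h g x)).
  by move=> x; rewrite /diff; ring.
have vg' := vanish_shift h vg.
apply: vanishD.
  case: a eab vf => [|a] eab vf.
    apply: (@eq_vanish _ (fun=> 0)); last exact: vanish_cst0.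
    by move=> x; have /= -> := vf [:: h] erefl x; rewrite mul0r.
  have [e] : (a + b).+1 = s.+1 by lia.
  by rewrite -e; apply: (IH a b e _ _ _ vg'); exact: (proj1 (vanishS _ _) vf h).
case: b eab vg {vg'} => [|b] eab vg.
  apply: (@eq_vanish _ (fun=> 0)); last exact: vanish_cst0.
  by move=> x; have /= -> := vg [:: h] erefl x; rewrite mulr0.
have [e] : (a + b).+1 = s.+1 by lia.
by rewrite -e; apply: (IH a b e _ _ vf); exact: (proj1 (vanishS _ _) vg h).
Qed.

End Differences.

(** * The derivative test and self-correction by plurality vote *)

Section DerivativeTest.
Context {R : realType} {V : finZmodType} {K : finFieldType}.
Implicit Types (f g F : V -> K) (h : V) (hs : seq V).

(** Union bound over the [2 ^ size hs] vertices of the cube, each of which is uniform when [x]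
    is. *)
Lemma avg_diffs_neq0 hs F :
  avg (fun x => (diffs hs F x != 0)%:R) <=
  2 ^+ size hs * avg (fun x => (F x != 0)%:R) :> R.
Proof.
elim: hs => [|h hs IH] /=; first by rewrite mul1r.
rewrite exprS -mulrA mulr2n mulrDl mul1r.
apply: le_trans (lerD IH IH).
rewrite -{1}(avg_shift h (fun x => (diffs hs F x != 0)%:R)) -avgD.
apply: le_avg => x; apply: le_indicD.
by rewrite -negb_and; apply: contra => /andP[/eqP e1 /eqP e2]; rewrite /diff e1 e2 subrr.
Qed.

(** Here [x] is fixed and the directions are random: every vertex except [x] is still uniform, which
    is why [x] has to be removed. *)
Lemma iavg_punct_neq0 k F x :
  iavg k (fun hs => (punct hs F x != 0)%:R) <=
  2 ^+ k * avg (fun x => (F x != 0)%:R) :> R.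
Proof.
elim: k => [|k IH] /=.
  by rewrite /punct /= mul1r subrr eqxx mul1r avg_ge0.
rewrite exprS -mulrA mulr2n mulrDl mul1r.
apply: (@le_trans _ _ (iavg k (fun hs => avg (fun y => (diffs hs F y != 0)%:R)) +
     iavg k (fun hs => (punct hs F x != 0)%:R))); last first.
  apply: lerD IH; rewrite -[leRHS](iavg_cst (0 : V) k); apply: le_iavg => hs <-.
  exact: avg_diffs_neq0.
rewrite avg_iavg -iavgD; apply: le_iavg => hs _.
have <- : avg (fun v => (diffs hs F (v + x) != 0)%:R + (punct hs F x != 0)%:R) =
  avg (fun y => (diffs hs F y != 0)%:R) + (punct hs F x != 0)%:R :> R.
  by rewrite avgD (avg_cst (0 : V)) (avg_shift x (fun y => (diffs hs F y != 0)%:R)).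
apply: le_avg => v; apply: le_indicD.
rewrite -negb_and; apply: contra => /andP[/eqP e1 /eqP e2].
by rewrite punct_cons addrC e2 oppr0 add0r addrC e1.
Qed.

(** The directions are fixed one at a time, each at the cost of a factor 2. After [k] of them
    nothing is random, and a probability below 1 is 0. *)
Lemma vanish_of_pointwise k F :
  (forall x, 2 ^+ k * iavg k (fun hs => (diffs hs F x != 0)%:R) < 1 :> R) ->
  vanish k F.
Proof.
elim: k F => [|k IH] F lt1.
  move=> [|//] _ x; apply/eqP/negPn/negP => nz.
  by have := lt1 x; rewrite mul1r /= nz ltxx.
apply/vanishS => a; apply: IH => x.
pose G y b : R := iavg k (fun hs => (diffs hs (diff b F) y != 0)%:R).
have Gavg y : avg (G y) = iavg k.+1 (fun hs => (diffs hs F y != 0)%:R).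
  by apply: eq_avg => b; apply: eq_iavg => hs _; rewrite -diffs_cons.
(* [diff a F x = diff (a + b) F x - diff b F (x + a)] for a random [b] *)
have le : G x a <= avg (G x) + avg (G (x + a)).
  rewrite -[leLHS](avg_cst (0 : V)) -(avg_shift a (G x)) -avgD.
  apply: le_avg => b; rewrite /G -iavgD; apply: le_iavg => hs _.
  apply: le_indicD; rewrite -negb_and; apply: contra => /andP[/eqP e1 /eqP e2].
  rewrite (@eq_diffs _ _ _ _ (fun y => diff (b + a) F y - diff b F (y + a))).
    by rewrite diffsB (diffs_shift _ (diff b F)) e1 e2 subrr.
  by move=> y; rewrite /diff -!addrA (addrC b); ring.
have := lt1 x; have := lt1 (x + a); rewrite -!Gavg exprS.
have k0 : 0 < 2 ^+ k :> R by rewrite exprn_gt0.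
rewrite -/(G x a) => h1 h2.
apply: le_lt_trans (ler_wpM2l (ltW k0) le) _.
rewrite mulrDr; lra.
Qed.

Variables (k : nat) (f : V -> K).
Let eta : R := avg (fun x => iavg k (fun hs => (diffs hs f x != 0)%:R)).
(** The share of votes for [c]. A vote [punct hs f x = c] predicts the value at [x] that makes the
    difference vanish, namely [- (-1) ^+ k * c]. *)
Let weight x c : R := iavg k (fun hs => (punct hs f x == c)%:R).

(** The sum of squares is the probability that two independent votes [hs], [hs'] agree. Both
    one-sided differences at [x] are compared with the mixed one, [diffs hs (diffs hs' f) x]: if
    both punctured mixed differences are 0, then [diffs hs f x = diffs hs' f x]. Each of them is
    nonzero with probability at most [2 ^ k * eta]. *)
Lemma weight_collision x : 1 - 2 ^+ k.+1 * eta <= \sum_c weight x c * weight x c.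
Proof.
have -> : \sum_c weight x c * weight x c =
  iavg k (fun hs => iavg k (fun hs' => (punct hs f x == punct hs' f x)%:R)).
  transitivity (\sum_c iavg k (fun hs => iavg k (fun hs' =>
      (punct hs f x == c)%:R * (punct hs' f x == c)%:R : R))).
    apply: eq_bigr => c _; rewrite {1}/weight mulrC -iavgZ.
    by apply: eq_iavg => hs _; rewrite mulrC -iavgZ.
  rewrite -iavg_sum; apply: eq_iavg => hs _.
  rewrite -iavg_sum; apply: eq_iavg => hs' _.
  rewrite (bigD1 (punct hs f x))//= eqxx mul1r eq_sym big1 ?addr0// => c.
  by rewrite eq_sym => /negPf ->; rewrite mul0r.
rewrite lerBlDl -lerBlDr.
have -> : 1 - iavg k (fun hs => iavg k (fun hs' => (punct hs f x == punct hs' f x)%:R))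
   = iavg k (fun hs => iavg k (fun hs' => (punct hs f x != punct hs' f x)%:R)) :> R.
  apply/eqP; rewrite subr_eq -iavgD eq_sym -[X in _ == X](iavg_cst (0 : V) k).
  by apply/eqP/eq_iavg => hs _; rewrite (iavg_predC (0 : V)) subrK.
have half : iavg k (fun hs' => iavg k (fun hs => (punct hs (diffs hs' f) x != 0)%:R))
   <= 2 ^+ k * eta.
  rewrite /eta avg_iavg -iavgZ; apply: le_iavg => hs' _; exact: iavg_punct_neq0.
rewrite exprS -mulrA mulr2n mulrDl mul1r.
apply: le_trans (lerD half half).
rewrite [X in _ <= X + _]exchange_iavg -iavgD; apply: le_iavg => hs sh.
rewrite -iavgD; apply: le_iavg => hs' sh'; apply: le_indicD.
rewrite -negb_and; apply: contra => /andP[].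
rewrite /punct sh sh' (diffsC hs hs') !subr_eq0 => /eqP -> /eqP e.
have s0 : (-1) ^+ k != 0 :> K by rewrite signr_eq0.
by apply/eqP; congr (_ - _); apply: (mulfI s0); rewrite e.
Qed.

(** Since the votes have total mass 1, the largest weight is at least the collision probability,
    hence at least 1/2. So where [f] and [g] differ the test fails with probability at least 1/2,
    giving distance at most [2 * eta]. For every [x] a difference of [g] is nonzero with probability
    at most [2 ^ k.+1 * eta + 2 ^ k * (2 * eta)]; times the [2 ^ k] of [vanish_of_pointwise], this
    is the assumed [4 ^ k.+1 * eta]. *)
Lemma self_correction :
  4 ^+ k.+1 * eta < 1 ->
  exists g, vanish k g /\ avg (fun x => (f x != g x)%:R) <= 2 * eta.
Proof.
move=> small.
pose c x := [arg max_(c > 0 | true) weight x c]%O.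
have weight_ge0 x a : 0 <= weight x a.
  by rewrite -(iavg_cst (0 : V) k 0); apply: le_iavg.
have wc x : 1 - 2 ^+ k.+1 * eta <= weight x (c x).
  apply: le_trans (weight_collision x) _.
  have cmax a : weight x a <= weight x (c x).
    by rewrite /c; case: arg_maxP => // i _ /(_ a); apply.
  apply: le_trans (_ : \sum_a weight x a * weight x (c x) <= _).
    by apply: ler_sum => a _; rewrite ler_wpM2l.
  rewrite -mulr_suml -iavg_sum.
  under eq_iavg => hs _.
    rewrite (bigD1 (punct hs f x))//= eqxx big1 ?addr0.
      over.
    by move=> a; rewrite eq_sym => /negPf ->.
  by rewrite (iavg_cst (0 : V)) mul1r.
pose s : K := (-1) ^+ k.
have ss : s * s = 1 by rewrite /s -expr2 sqrr_sign.
pose g x := - s * c x.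
have eta0 : 0 <= eta.
  apply: avg_ge0 => x; rewrite -(iavg_cst (0 : V) k 0).
  exact: le_iavg.
have p2 : 2 <= 2 ^+ k.+1 :> R by rewrite exprS ler_peMr// exprn_ege1// ler1n.
have e4 : 4 ^+ k.+1 = 2 ^+ k.+1 * 2 ^+ k.+1 :> R.
  by rewrite -exprMn; congr (_ ^+ _); ring.
have wc2 x : 1 / 2 <= weight x (c x).
  apply: le_trans (wc x).
  have : 2 * (2 ^+ k.+1 * eta) <= 4 ^+ k.+1 * eta.
    by rewrite e4 -mulrA ler_wpM2r// mulr_ge0// exprn_ge0.
  lra.
have fg : avg (fun x => (f x != g x)%:R) <= 2 * eta.
  rewrite -ler_pdivrMl// mulrC -[leLHS]mulr1 -mulrA mulrC -avgZ; apply: le_avg => x.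
  apply: le_trans (_ : (f x != g x)%:R * weight x (c x) <= _).
    by rewrite mulr1 mulrC ler_wpM2l// -div1r.
  rewrite -iavgZ; apply: le_iavg => hs sh; rewrite -natrM mulnb.
  apply: le_indic => /andP[ne /eqP e]; apply: contra ne => /eqP d0.
  move: e; rewrite /punct d0 sh sub0r /g -/s => <-.
  by rewrite mulrN !mulNr mulrA ss mul1r opprK.
exists g; split=> //; apply: (@vanish_of_pointwise k g) => x.
have : iavg k (fun hs => (diffs hs g x != 0)%:R) <=
   2 ^+ k.+1 * eta + 2 ^+ k * avg (fun x => (f x != g x)%:R).
  apply: le_trans (_ : iavg k (fun hs => (punct hs f x != c x)%:R) +
      iavg k (fun hs => (punct hs (fun y => f y - g y) x != 0)%:R) <= _).
    rewrite -iavgD; apply: le_iavg => hs sh; apply: le_indicD.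
    rewrite -negb_and; apply: contra => /andP[/eqP e1].
    rewrite punctB subr_eq0 e1 => /eqP e2.
    by rewrite -[diffs _ _ _](subrK ((-1) ^+ size hs * g x)) -/(punct hs g x) -e2
      sh /g -/s mulrA mulrN ss mulN1r subrr.
  apply: lerD.
    by rewrite (iavg_predC (0 : V)); have := wc x; rewrite /weight; lra.
  apply: le_trans (iavg_punct_neq0 _ _ _) _.
  by rewrite ler_wpM2l ?exprn_ge0//; apply: le_avg => y; rewrite subr_eq0.
have k0 : 0 < 2 ^+ k :> R by rewrite exprn_gt0.
move=> le; apply: le_lt_trans (ler_wpM2l (ltW k0) le) _.
apply: le_lt_trans small; rewrite e4 exprS; set X := 2 ^+ k.
have -> : 2 * X * (2 * X) * eta = X * (2 * X * eta + X * (2 * eta)) by ring.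
by rewrite ler_wpM2l ?(ltW k0)// lerD2l ler_wpM2l ?(ltW k0).
Qed.

End DerivativeTest.

(* Passing to a derivative at most doubles the density of the support. *)
Lemma vanish_density (R : realType) (V : finZmodType) (K : finFieldType)
    (d : nat) (g : V -> K) (x : V) :
  vanish d.+1 g -> g x != 0 -> 1 <= 2 ^+ d * avg (fun y => (g y != 0)%:R) :> R.
Proof.
elim: d g x => [|d IH] g x vg gx.
  rewrite mul1r -[leLHS](avg_cst (0 : V)); apply: le_avg => y.
  suff -> : g y = g x by rewrite gx.
  have := vg [:: y - x] erefl x; rewrite /= /diff [x + _]addrC subrK => /eqP.
  by rewrite subr_eq0 => /eqP.
case: (pselect (exists h, exists y, diff h g y != 0)) => [[h [y hy]]|nex].
  move/vanishS/(_ h): vg => /IH/(_ hy) /le_trans; apply.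
  rewrite exprSr -mulrA ler_wpM2l ?exprn_ge0//.
  by have := @avg_diffs_neq0 R V K [:: h] g; rewrite expr1.
have -> : avg (fun y => (g y != 0)%:R) = 1 :> R.
  rewrite -[RHS](avg_cst (0 : V)); apply: eq_avg => y.
  suff -> : g y = g x by rewrite gx.
  apply/eqP; rewrite -subr_eq0; apply/negPn/negP => ne; apply: nex.
  by exists (y - x), x; rewrite /diff [x + _]addrC subrK.
by rewrite mulr1 exprn_ege1// ler1n.
Qed.

(** * Degree and vanishing differences *)

Section Newton.
Context {V : finZmodType} {K : fieldType}.

Lemma vanish_diffs k (hs : seq V) (f : V -> K) :
  vanish (k + size hs) f -> vanish k (diffs hs f).
Proof. by move=> v s sk x; rewrite -diffs_cat v// size_cat sk. Qed.

(** The range of summation does not depend on [j]: in [vanish_deg_le], [j] is a coordinate of the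
    point, while the number of terms must be the same at all points. *)
Lemma newton_forward (f : V -> K) (h y : V) (N j : nat) : (j <= N)%N ->
  f (y + h *+ j) = \sum_(i < N.+1) 'C(j, i)%:R * diffs (nseq i h) f y.
Proof.
elim: j y => [|j IH] y jN.
  rewrite mulr0n addr0 big_ord_recl bin0 mul1r big1 ?addr0// => i _.
  by rewrite bin0n mul0r.
rewrite mulrS addrA IH ?(ltnW jN)//.
pose a i := diffs (nseq i h) f y.
have ea i : diffs (nseq i h) f (y + h) = a i.+1 + a i by rewrite /a /= /diff subrK.
under eq_bigr do rewrite ea mulrDr.
rewrite big_split /= big_ord_recr /= bin_small// mul0r addr0.
rewrite [in RHS]big_ord_recl [X in _ + X]big_ord_recl /= !bin0.
rewrite addrCA; congr (_ + _); rewrite -big_split; apply: eq_bigr => i _ /=.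
by rewrite /bump /= !add1n binS natrD mulrDl addrC.
Qed.

Lemma diffs_affine (U : finZmodType) (A L : U -> V) (f : V -> K) (hs : seq U) z :
  (forall z h, A (z + h) = A z + L h) ->
  diffs hs (f \o A) z = diffs (map L hs) f (A z).
Proof. by move=> AL; elim: hs z => //= h hs IH z; rewrite /diff !IH AL. Qed.

End Newton.

Section Degree.
Variables (p : nat) (p_prime : prime p).

Lemma vanish_monomial n (r : seq 'I_n) (e : 'I_n -> nat) :
  vanish (\sum_(i <- r) e i).+1
    (fun x : point p n => \prod_(i <- r) (x i : 'F_p) ^+ e i).
Proof.
have v1 c : vanish 1 (fun _ : point p n => c : 'F_p).
  by apply/vanishS => h [|//] _ x; rewrite /= /diff subrr.
elim: r => [|i r IH].
  by rewrite big_nil; apply: eq_vanish (v1 1) => x; rewrite big_nil.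
rewrite big_cons.
apply: (@eq_vanish _ _ _ (fun x : point p n => (x i) ^+ e i * \prod_(j <- r) x j ^+ e j)).
  by move=> x; rewrite big_cons.
apply: vanishM IH; elim: (e i) => [|k IHk].
  by apply: eq_vanish (v1 1) => x; rewrite expr0.
apply: (@eq_vanish _ _ _ (fun x : point p n => x i * (x i) ^+ k)).
  by move=> x; rewrite exprS.
apply: (@vanishM _ _ 1 k) IHk; apply/vanishS => h.
apply: eq_vanish (v1 (h i)) => x.
by rewrite /diff ffunE addrAC subrr add0r.
Qed.

Lemma deg_le_vanish n d (f : point p n -> 'F_p) : deg_le d f -> vanish d.+1 f.
Proof.
move=> [C [C0 fE]].
apply: (@eq_vanish _ _ _ (fun x => \sum_m C m * monomial m x)) => [x|].
  by rewrite fE.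
apply: vanish_sum => e; case: (leqP (\sum_(i < n) e i) d) => [le|lt].
  apply: vanishZ; apply: (@vanishW _ _ (\sum_i e i).+1); first by rewrite ltnS.
  exact: vanish_monomial.
apply: (@eq_vanish _ _ _ (fun=> 0)); last exact: vanish_cst0.
by move=> x; rewrite C0// mul0r.
Qed.

Section ClosureProperties.
Variable n : nat.
Implicit Types (f g : point p n -> 'F_p) (c : 'F_p).

Lemma eq_deg_le d f g : f =1 g -> deg_le d f -> deg_le d g.
Proof. by move=> e [C [C0 fE]]; exists C; split=> // x; rewrite -e fE. Qed.

Lemma deg_leW d d' f : (d <= d')%N -> deg_le d f -> deg_le d' f.
Proof.
move=> dd [C [C0 fE]]; exists C; split=> // e he.
by apply: C0; apply: leq_ltn_trans he.
Qed.

Lemma deg_le0 d : deg_le d (fun _ : point p n => 0 : 'F_p).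
Proof. by exists (fun=> 0); split=> // x; rewrite big1// => m _; rewrite mul0r. Qed.

Lemma deg_leD d f g : deg_le d f -> deg_le d g -> deg_le d (fun x => f x + g x).
Proof.
move=> [C [C0 fE]] [C' [C0' gE]]; exists (fun e => C e + C' e); split=> [e he|x].
  by rewrite C0// C0'// addr0.
by rewrite fE gE -big_split; apply: eq_bigr => m _ /=; rewrite mulrDl.
Qed.

Lemma deg_leZ d c f : deg_le d f -> deg_le d (fun x => c * f x).
Proof.
move=> [C [C0 fE]]; exists (fun e => c * C e); split=> [e he|x].
  by rewrite C0// mulr0.
by rewrite fE mulr_sumr; apply: eq_bigr => m _; rewrite mulrA.
Qed.

Lemma deg_le_sum d (I : Type) (r : seq I) (F : I -> point p n -> 'F_p) :
  (forall i, deg_le d (F i)) -> deg_le d (fun x => \sum_(i <- r) F i x).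
Proof.
move=> v; elim: r => [|i r IH].
  by apply: eq_deg_le (@deg_le0 d) => x; rewrite big_nil.
by apply: eq_deg_le (deg_leD (v i) IH) => x; rewrite big_cons.
Qed.

(** Products of monomials leave the exponent range below [p]; the identity [x ^+ p = x] brings them
    back without raising the degree. *)
Lemma exp_reduce k : exists j : 'I_p, (j <= k)%N /\ forall x : 'F_p, x ^+ k = x ^+ j.
Proof.
have p1 := prime_gt1 p_prime.
elim/ltn_ind: k => k IH; case: (ltnP k p) => [kp|pk]; first by exists (Ordinal kp).
have [|j [jk jE]] := IH (k - p).+1; first by lia.
exists j; split=> [|x]; first by lia.
by rewrite -jE exprS -{2}[x]expf_card card_Fp// -exprD subnKC.
Qed.

Lemma deg_le_monomial (e : 'I_n -> nat) :
  deg_le (\sum_i e i) (fun x : point p n => \prod_i x i ^+ e i).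
Proof.
have /fin_all_exists[j jP] := fun i => exp_reduce (e i).
pose m := [ffun i => j i] : {ffun 'I_n -> 'I_p}.
exists (fun m' => (m' == m)%:R); split=> [m' he|x].
  case: eqP he => // ->; rewrite ltnNge => /negP[]; apply: leq_sum => i _.
  by rewrite ffunE; case: (jP i).
rewrite [RHS](bigD1 m)//= eqxx mul1r [X in _ + X]big1 ?addr0; last first.
  by move=> m' /negPf ->; rewrite mul0r.
by apply: eq_bigr => i _; rewrite ffunE; case: (jP i).
Qed.

Lemma deg_le_cst c : deg_le 0 (fun _ : point p n => c).
Proof.
have := deg_leZ c (deg_le_monomial (fun=> 0%N)); rewrite big1//.
by apply: eq_deg_le => x; rewrite big1// mulr1.
Qed.

Lemma deg_le_coord i : deg_le 1 (fun x : point p n => x i).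
Proof.
have := deg_le_monomial (fun j => (j == i) : nat).
rewrite (bigD1 i)//= eqxx big1; last by move=> j /negPf ->.
apply: eq_deg_le => x.
by rewrite (bigD1 i)//= eqxx expr1 big1 ?mulr1// => j /negPf ->; rewrite expr0.
Qed.

Lemma deg_leM a b f g : deg_le a f -> deg_le b g -> deg_le (a + b) (fun x => f x * g x).
Proof.
move=> [C [C0 fE]] [C' [C0' gE]].
apply: (@eq_deg_le _ (fun x => \sum_m \sum_m' (C m * C' m') * (monomial m x * monomial m' x))).
  move=> x; rewrite fE gE mulr_suml; apply: eq_bigr => m _.
  by rewrite mulr_sumr; apply: eq_bigr => m' _; rewrite mulrACA.
apply: deg_le_sum => m; apply: deg_le_sum => m'.
have [ma|am] := leqP (\sum_i m i) a; last first.
  by apply: eq_deg_le (@deg_le0 _) => x; rewrite C0// !mul0r.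
have [mb|bm] := leqP (\sum_i m' i) b; last first.
  by apply: eq_deg_le (@deg_le0 _) => x; rewrite C0'// mulr0 mul0r.
apply: deg_leZ; have := deg_le_monomial (fun i => m i + m' i)%N.
move/(@deg_leW _ (a + b)); rewrite big_split leq_add// => /(_ isT).
apply: eq_deg_le => x; rewrite /monomial -big_split.
by apply: eq_bigr => i _ /=; rewrite exprD.
Qed.

(** The recurrence [i.+1 * 'C(x, i.+1) = (x - i) * 'C(x, i)] can be divided by [i.+1], which is
    invertible below [p]. Truncated subtraction is harmless: if [x k < i], the binomial factor is
    0. *)
Lemma deg_le_binomial (k : 'I_n) i : (i < p)%N ->
  deg_le i (fun x : point p n => 'C(x k, i)%:R : 'F_p).
Proof.
elim: i => [|i IH] ip.
  by apply: eq_deg_le (deg_le_cst 1) => x; rewrite bin0.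
have i0 : i.+1%:R != 0 :> 'F_p.
  by rewrite -(dvdn_pcharf (pchar_Fp p_prime)) gtnNdvd.
have vx : deg_le 1 (fun x : point p n => x k + - i%:R).
  apply: deg_leD (deg_le_coord k) _.
  by apply: deg_leW (deg_le_cst _).
have := deg_leZ (i.+1%:R^-1) (deg_leM vx (IH (ltnW ip))).
rewrite add1n; apply: eq_deg_le => x.
apply: (mulfI i0); rewrite mulVKf// -natrM mul_bin_left.
have [xi|ix] := ltnP (x k) i.
  by rewrite bin_small// muln0 mulr0.
by rewrite natrM natrB// natr_Zp.
Qed.

End ClosureProperties.

(** Induction on the number [k] of coordinates kept by [tau k]. Newton's formula along the next
    coordinate has coefficients [diffs (nseq i eps) g] evaluated at [tau k x]; they have degree at
    most [d' - i], and ['C(x ko, i)] supplies the missing [i]. Terms with [i > d'] vanish. *)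
Lemma vanish_deg_le n d (f : point p n -> 'F_p) : vanish d.+1 f -> deg_le d f.
Proof.
pose tau k (x : point p n) : point p n := [ffun i : 'I_n => if (i < k)%N then x i else 0].
suff trunc k d' (g : point p n -> 'F_p) : (k <= n)%N -> vanish d'.+1 g -> deg_le d' (g \o tau k).
  move=> /(trunc n _ _ (leqnn n)); apply: eq_deg_le => x /=.
  by congr (f _); apply/ffunP => i; rewrite ffunE ltn_ord.
elim: k d' g => [|k IH] d' g kn vg.
  apply: (@eq_deg_le _ _ (fun=> g 0)); last by apply: deg_leW (deg_le_cst _ _).
  by move=> x /=; congr (g _); apply/ffunP => i; rewrite !ffunE.
pose ko := Ordinal kn; pose eps : point p n := [ffun i => (i == ko)%:R].
apply: (@eq_deg_le _ _ (fun x : point p n => \sum_(i < p)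
    'C(x ko, i)%:R * diffs (nseq i eps) g (tau k x))).
  move=> x /=; have -> : tau k.+1 x = tau k x + eps *+ (x ko).
    apply/ffunP => i; rewrite !ffunE ffunMnE ffunE.
    rewrite ltnS leq_eqVlt -[(i : nat) == k]/(i == ko).
    case: eqVneq => [->|ne] /=; first by rewrite ltnn add0r natr_Zp.
    by rewrite mul0rn addr0.
  have xp : (x ko <= p.-1)%N.
    by rewrite -ltnS prednK ?prime_gt0// -[X in (_ < X)%N](Fp_cast p_prime) ltn_ord.
  by rewrite (newton_forward _ _ _ xp) prednK ?prime_gt0.
apply: deg_le_sum => i.
have [id|di] := leqP i d'.
  rewrite -(subnKC id); apply: deg_leM; first exact: deg_le_binomial.
  apply: IH (ltnW kn) _; apply: vanish_diffs.
  by rewrite size_nseq addSn subnK.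
apply: eq_deg_le (@deg_le0 _ _) => x.
suff -> : diffs (nseq i eps) g (tau k x) = 0 by rewrite mulr0.
by apply: (vanishW di vg); rewrite size_nseq.
Qed.

(** An affine map carries cubes to cubes, so the criterion by differences transfers directly. *)
Lemma deg_le_affine m n d (A L : point p m -> point p n) (f : point p n -> 'F_p) :
  (forall z h, A (z + h) = A z + L h) -> deg_le d f -> deg_le d (f \o A).
Proof.
move=> AL /deg_le_vanish v; apply: vanish_deg_le => hs sh z.
by rewrite (diffs_affine _ _ _ AL) v// size_map.
Qed.

Lemma derivative_test (R : realType) n d (delta : R) (f : point p n -> 'F_p) :
  delta <= 1 -> far_from_deg d delta f ->
  delta <= 4 ^+ d.+2 * avg (fun x => iavg d.+1 (fun hs => (diffs hs f x != 0)%:R)).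
Proof.
move=> delta1 far; rewrite leNgt; apply/negP => lt.
have [|g [/vanish_deg_le/far dg fg]] := @self_correction R _ _ d.+1 f.
  exact: lt_le_trans lt delta1.
move: dg; rewrite /dist -avg_pred => /le_trans/(_ fg).
rewrite leNgt => /negP; apply; apply: le_lt_trans lt.
have h4 : 1 <= 4 ^+ d :> R by rewrite exprn_ege1// ler1n.
rewrite ler_wpM2r//; last by rewrite !exprS; lra.
by apply: avg_ge0 => x; rewrite -(iavg_cst (0 : point p n) d.+1 0); apply: le_iavg.
Qed.

(** * Counting polynomials of bounded degree *)

Definition low_exp m d := {e : {ffun 'I_m -> 'I_p} | (\sum_i e i <= d)%N}.

Definition poly_of m d (c : {ffun low_exp m d -> 'F_p}) (x : point p m) : 'F_p :=
  \sum_e c e * monomial (val e) x.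

Lemma poly_ofP m d (f : point p m -> 'F_p) :
  deg_le d f -> exists c : {ffun low_exp m d -> 'F_p}, f =1 poly_of c.
Proof.
move=> [C [C0 fE]]; exists [ffun e => C (val e)] => x; rewrite fE.
rewrite (bigID (fun e : {ffun 'I_m -> 'I_p} => \sum_i e i <= d)%N) /=.
rewrite [X in _ + X]big1 ?addr0; last first.
  by move=> e; rewrite -ltnNge => /C0 ->; rewrite mul0r.
rewrite (reindex_omap (val : low_exp m d -> _) insub) => [|e he]; last by rewrite insubT.
apply: eq_big => e; last by rewrite ffunE.
by rewrite valK eqxx andbT; apply: valP e.
Qed.

Lemma deg_le_poly_of m d (c : {ffun low_exp m d -> 'F_p}) : deg_le d (poly_of c).
Proof.
apply: deg_le_sum => e; apply: deg_leZ.
by apply: deg_leW (deg_le_monomial _); apply: valP e.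
Qed.

Lemma card_poly_of m d : #|{ffun low_exp m d -> 'F_p}| = (p ^ #|{: low_exp m d}|)%N.
Proof. by rewrite card_ffun card_Fp. Qed.

(* Markov's bound for the generating function [sum_e x^|e| <= (1 - x)^-m]. *)
Lemma low_exp_bound (R : realType) m d (x : R) : 0 <= x <= 1 ->
  #|{: low_exp m d}|%:R * x ^+ d * (1 - x) ^+ m <= 1.
Proof.
move=> /andP[x0 x1].
have ge0 : 0 <= 1 - x by lra.
have h : #|{: low_exp m d}|%:R * x ^+ d <= \prod_(i < m) \sum_(j < p) x ^+ j.
  rewrite bigA_distr_bigA /= card_sig -sum1_card natr_sum mulr_suml.
  rewrite [leRHS](bigID (fun e : {ffun 'I_m -> 'I_p} => \sum_i e i <= d)%N) /=.
  rewrite -[leLHS]addr0 lerD ?sumr_ge0//; last first.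
    by move=> e _; apply: prodr_ge0 => i _; rewrite exprn_ge0.
  apply: ler_sum => e ed; rewrite mul1r prodrXr.
  by apply: ler_wiXn2l.
apply: le_trans (ler_wpM2r (exprn_ge0 _ ge0) h) _.
rewrite prodr_const card_ord -exprMn exprn_ile1//.
  by rewrite mulr_ge0// sumr_ge0// => i _; rewrite exprn_ge0.
have -> : (\sum_(j < p) x ^+ j) * (1 - x) = 1 - x ^+ p.
  by rewrite -[1 - x]opprB mulrN mulrC -subrX1 opprB.
by rewrite gerBl exprn_ge0.
Qed.

End Degree.

(** * Independent samples *)

Section Samples.
Context {R : realType} {I T : finType}.
Implicit Types r : {ffun I -> T}.

Definition upd r i (z : T) : {ffun I -> T} := [ffun j => if j == i then z else r j].

Lemma upd_eq r i z : upd r i z i = z.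
Proof. by rewrite ffunE eqxx. Qed.

Lemma upd_neq r i z j : j != i -> upd r i z j = r j.
Proof. by move=> /negPf ji; rewrite ffunE ji. Qed.

Lemma updK r i z z' : upd (upd r i z) i z' = upd r i z'.
Proof. by apply/ffunP => j; rewrite !ffunE; case: eqP. Qed.

Lemma upd_id r i : upd r i (r i) = r.
Proof. by apply/ffunP => j; rewrite !ffunE; case: eqP => // ->. Qed.

Lemma avg_upd i (F : {ffun I -> T} -> R) :
  avg F = avg (fun r => avg (fun z => F (upd r i z))).
Proof.
apply: (avg_resample (get := fun r => r i)) => *;
  [exact: upd_eq | exact: updK | exact: upd_id].
Qed.

Lemma avg_coord (x0 : T) i (F : T -> R) : avg (fun r : {ffun I -> T} => F (r i)) = avg F.
Proof.
rewrite (avg_upd i); under eq_avg do under eq_avg do rewrite upd_eq.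
by rewrite (avg_cst [ffun=> x0]).
Qed.

Lemma avg_prod (F : I -> T -> R) :
  avg (fun r : {ffun I -> T} => \prod_i F i (r i)) = \prod_i avg (F i).
Proof.
rewrite /avg prodf_div prodr_const card_ffun natrX; congr (_ / _).
by rewrite bigA_distr_bigA.
Qed.

End Samples.

(** * Testing through independent samples under online corruption *)

Section Tester.
Context {R : realType} (p n m d t M' N' : nat) {A : finType} (a0 : A).
Variable phi : A -> point p m -> point p n.
Let M := M'.+1.
Let N := N'.+1.
Let q := (M * N)%N.
Let z0 : {ffun 'I_N'.+1 -> point p m} := [ffun=> [ffun=> 0]].

(** One entry per round: a parameter in [A] and the sample points of that round. [A] is the type of
    affine maps in [affine_tester] and [unit] in [point_tester]. *)
Definition seed := {ffun 'I_M'.+1 -> A * {ffun 'I_N'.+1 -> point p m}}.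
Implicit Type r : seed.

Definition query_point r (k : nat) : point p n :=
  let s := r (inord (k %/ N)) in phi s.1 (s.2 (inord (k %% N))).

Definition tester_query r (ans : seq 'F_p) := query_point r (size ans).

Definition consistent (I : finType) (z : {ffun I -> point p m}) (v : I -> 'F_p) :=
  exists g : point p m -> 'F_p, deg_le d g /\ forall j, g (z j) = v j.

Definition tester_decision r (ans : seq 'F_p) : bool :=
  `[< forall i, consistent (r i).2 (fun j => nth 0 ans (i * N + j)) >].

Variables (f : point p n -> 'F_p) (adv : seq (point p n) -> point p n -> 'F_p).
Hypothesis adv_ok : online_adversary t f adv.

Let history r k := [seq query_point r i | i <- iota 0 k].

Lemma run_tester r k : run (tester_query r) adv k =
  (history r k, [seq adv (history r i) (query_point r i) | i <- iota 0 k]).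
Proof.
elim: k => // k IH.
have iotaS : iota 0 k.+1 = rcons (iota 0 k) k by rewrite -addn1 iotaD cats1.
by rewrite /history iotaS !map_rcons /= IH /tester_query size_map size_iota.
Qed.

Lemma corrupted_points s : (#|[pred y | adv s y != f y]| <= t * size s)%N.
Proof.
have [adv0 advS] := adv_ok.
elim/last_ind: s => [|s x IH].
  by rewrite muln0 leqn0; apply/eqP/eq_card0 => y; rewrite !inE adv0 eqxx.
rewrite size_rcons mulnS.
apply: leq_trans (leq_add (advS s x) IH).
rewrite -cardUI; apply: leq_trans (leq_addr _ _).
apply: subset_leq_card; apply/subsetP => y; rewrite !inE; apply: contraR.
by rewrite negb_or !negbK => /andP[/eqP -> /eqP ->].
Qed.

Definition corrupted r k := adv (history r k) (query_point r k) != f (query_point r k).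

Variables (w : A -> R) (tau : R).
Hypothesis w_fiber : forall a y, avg (fun z => (phi a z == y)%:R) <= w a.
Hypothesis w_tau : avg w <= tau.

Lemma index_lt k : (k < q)%N -> (k %/ N < M)%N.
Proof. by move=> kq; rewrite ltn_divLR. Qed.

(** Only the [k]-th sample is resampled. The earlier queries, hence the at most [t * k] corrupted
    points, stay fixed, and each is hit with probability at most [w a]. As [a] is held fixed
    meanwhile, the corruptions may depend on it; [w] is averaged only at the end. *)
Lemma avg_corrupted k : (k < q)%N -> avg (fun r => (corrupted r k)%:R) <= (t * k)%:R * tau.
Proof.
move=> kq; pose i : 'I_M'.+1 := inord (k %/ N); pose j : 'I_N'.+1 := inord (k %% N).
pose up r z : seed := upd r i ((r i).1, upd (r i).2 j z).
rewrite (avg_resample (get := fun r : seed => (r i).2 j) (upd := up)); first last.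
- by move=> r; rewrite /up upd_id -surjective_pairing upd_id.
- by move=> r z z'; rewrite /up updK upd_eq /= updK.
- by move=> r z; rewrite /up upd_eq /= upd_eq.
apply: le_trans (_ : avg (fun r : seed => (t * k)%:R * w (r i).1) <= _); last first.
  rewrite avgZ ler_wpM2l// (avg_coord (a0, z0) i (fun s => w s.1)).
  rewrite avg_pair; apply: le_trans w_tau; apply: le_avg => a /=.
  by rewrite (avg_cst z0).
apply: le_avg => r.
have hist z : history (up r z) k = history r k.
  apply/eq_in_map => l; rewrite mem_iota add0n /= => lk.
  rewrite /query_point /up; have lq := ltn_trans lk kq.
  have [ei|ni] := eqVneq (inord (l %/ N) : 'I_M'.+1) i; last by rewrite upd_neq.
  rewrite ei upd_eq /= upd_neq//; apply/eqP => /(congr1 (@nat_of_ord _)).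
  rewrite /j !inordK ?ltn_pmod// => ej.
  move/(congr1 (@nat_of_ord _)): ei; rewrite /i !inordK ?index_lt// => ei.
  by move: lk; rewrite (divn_eq l N) (divn_eq k N) ei ej ltnn.
pose B := [pred y | adv (history r k) y != f y].
apply: le_trans (_ : avg (fun z => \sum_(y in B) (phi (r i).1 z == y)%:R) <= _).
  apply: le_avg => z.
  rewrite /corrupted hist /query_point -/i -/j /up upd_eq /= upd_eq.
  set y := phi _ _; case: (boolP (y \in B)) => [yB|]; last first.
    by rewrite inE => /negPf ->; exact: sumr_ge0.
  by rewrite (bigD1 y)//= eqxx; move: yB; rewrite inE => ->; rewrite lerDl sumr_ge0.
rewrite avg_sum.
apply: le_trans (_ : \sum_(y in B) w (r i).1 <= _); first by apply: ler_sum.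
rewrite sumr_const -[leLHS]mulr_natl ler_wpM2r//.
  by apply: le_trans (w_fiber _ 0); apply: avg_ge0.
by rewrite ler_nat; have := corrupted_points (history r k); rewrite size_map size_iota.
Qed.

Hypothesis small_corruption : t%:R * q%:R ^+ 2 * tau <= 1 / 6.

Let bad r := has (corrupted r) (iota 0 q).

Lemma tau_ge0 : 0 <= tau.
Proof.
apply: le_trans w_tau; apply: avg_ge0 => a.
by apply: le_trans (w_fiber a 0); apply: avg_ge0.
Qed.

Lemma avg_bad : avg (fun r => (bad r)%:R) <= 1 / 6 :> R.
Proof.
apply: le_trans small_corruption.
apply: le_trans (_ : avg (fun r => \sum_(k <- iota 0 q) (corrupted r k)%:R) <= _).
  by apply: le_avg => r; apply: le_indic_has.
rewrite avg_sum.
apply: le_trans (_ : \sum_(k <- iota 0 q) (t * q)%:R * tau <= _).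
  rewrite big_seq [leRHS]big_seq; apply: ler_sum => k; rewrite mem_iota add0n /= => kq.
  apply: le_trans (avg_corrupted kq) _.
  by rewrite ler_wpM2r ?tau_ge0// ler_nat leq_mul2l ltnW ?orbT.
rewrite big_const_seq count_predT size_iota iter_addr_0 natrM.
by rewrite -[leLHS]mulr_natr le_eqVlt; apply/orP; left; apply/eqP; ring.
Qed.

Let honest (s : A * {ffun 'I_N'.+1 -> point p m}) : bool :=
  `[< consistent s.2 (fun j => f (phi s.1 (s.2 j))) >].

Lemma decision_honest r : ~~ bad r ->
  tester_decision r (run (tester_query r) adv q).2 = [forall i, honest (r i)].
Proof.
move=> nbad; rewrite run_tester /=.
have ansE (i : 'I_M'.+1) (j : 'I_N'.+1) :
    nth 0 [seq adv (history r k) (query_point r k) | k <- iota 0 q] (i * N + j)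
    = f (phi (r i).1 ((r i).2 j)).
  have lt : (i * N + j < q)%N.
    apply: (@leq_trans (i * N + N)); first by rewrite ltn_add2l.
    by rewrite -mulSnr leq_mul2r ltn_ord orbT.
  rewrite (nth_map 0%N) ?size_iota// nth_iota// add0n.
  have := hasPn nbad (i * N + j)%N; rewrite mem_iota add0n lt => /(_ isT)/negPn/eqP ->.
  rewrite /query_point divnMDl// divn_small ?ltn_ord// addn0 modnMDl modn_small ?ltn_ord//.
  by rewrite !inord_val.
apply/asboolP/forallP => H i.
  by apply/asboolP; have [g [dg gE]] := H i; exists g; split=> // j; rewrite gE ansE.
by have /asboolP[g [dg gE]] := H i; exists g; split=> // j; rewrite gE ansE.
Qed.

Let accept := accept_prob R q tester_query tester_decision adv.

Lemma accept_avg :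
  accept = avg (fun r => (tester_decision r (run (tester_query r) adv q).2)%:R).
Proof. by rewrite avg_pred. Qed.

Let r0 : seed := [ffun=> (a0, z0)].

Lemma tester_complete : (forall a, deg_le d (f \o phi a)) -> 2 / 3 <= accept.
Proof.
move=> deg; have := avg_bad; rewrite accept_avg => hb.
apply: (@le_trans _ _ (1 - avg (fun r => (bad r)%:R))); first by lra.
rewrite -(avg_predC r0); apply: le_avg => r; apply: le_indic => nbad.
rewrite decision_honest//; apply/forallP => i; apply/asboolP.
by exists (f \o phi (r i).1); split=> // j.
Qed.

(** Outside [bad] the run coincides with the honest one, whose rounds are independent, so that its
    acceptance probability is an [M]-th power. *)
Lemma tester_sound :
  avg (fun s : A * {ffun 'I_N'.+1 -> point p m} =>
    (`[< consistent s.2 (fun j => f (phi s.1 (s.2 j))) >])%:R : R) ^+ M <= 1 / 6 ->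
  2 / 3 <= 1 - accept.
Proof.
move=> hM; have hb := avg_bad; rewrite accept_avg.
suff : avg (fun r => (tester_decision r (run (tester_query r) adv q).2)%:R) <=
  avg (fun r => (bad r)%:R) + avg (fun r : seed => \prod_i (honest (r i))%:R) :> R.
  rewrite (avg_prod (fun=> fun s => (honest s)%:R)) prodr_const card_ord.
  rewrite -/M; move: hM; rewrite -/honest; lra.
rewrite -avgD; apply: le_avg => r.
by rewrite prod_indic; apply: le_indicD; case: (boolP (bad r)) => //= /decision_honest ->.
Qed.

End Tester.

(** * Consistency of random samples with a low-degree polynomial *)

Section Rounds.
Context {R : realType} (p m d : nat) (p_prime : prime p).
Implicit Types (F g : point p m -> 'F_p).
Local Notation D := #|{: low_exp p m d}|.

Lemma consistent_union_bound N F (delta : R) :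
  (forall g, deg_le d g -> delta <= avg (fun x => (F x != g x)%:R)) ->
  avg (fun z : {ffun 'I_N -> point p m} => (`[< consistent d z (fun j => F (z j)) >])%:R)
    <= (p ^ D)%:R * (1 - delta) ^+ N.
Proof.
move=> far.
apply: le_trans (_ : avg (fun z : {ffun 'I_N -> point p m} =>
    \sum_(c : {ffun low_exp p m d -> 'F_p}) \prod_j (poly_of c (z j) == F (z j))%:R) <= _).
  apply: le_avg => z; under eq_bigr do rewrite prod_indic.
  apply: le_trans (le_indic_exists _); apply: le_indic => /asboolP[g [/poly_ofP[c gE] zE]].
  by apply/existsP; exists c; apply/forallP => j; rewrite -gE zE.
rewrite avg_sum -card_poly_of// -sum1_card natr_sum mulr_suml; apply: ler_sum => c _.
rewrite (avg_prod (fun=> fun x => (poly_of c x == F x)%:R)) prodr_const card_ord mul1r.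
have := far _ (deg_le_poly_of p_prime c) => dc.
apply: lerXn2r; rewrite ?nnegrE ?avg_ge0//.
  by rewrite subr_ge0; apply: le_trans dc _; apply: (avg_mass (0 : point p m)).
rewrite lerBrDl -lerBrDr -(avg_predC (0 : point p m)).
by apply: le_trans dc _; apply: le_avg => x; rewrite eq_sym.
Qed.

(* The first [N0] samples determine the polynomial with probability at least 1/2;
   the last one then catches an error with probability at least [rho]. *)
Lemma consistent_one_extra N0 F (rho : R) : 0 <= rho ->
  (p ^ D)%:R * (1 - (2 ^+ d)^-1) ^+ N0 <= 1 / 2 :> R ->
  (forall g, deg_le d g -> rho <= avg (fun x => (F x != g x)%:R)) ->
  avg (fun z : {ffun 'I_N0.+1 -> point p m} =>
    (`[< consistent d z (fun j => F (z j)) >])%:R) <= 1 - rho / 2.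
Proof.
move=> rho0 det_large far.
have rho1 : rho <= 1.
  by apply: le_trans (far _ (deg_le0 _ _ _)) _; apply: (avg_mass (0 : point p m)).
pose hit (c : {ffun low_exp p m d -> 'F_p}) (z : {ffun 'I_N0.+1 -> point p m}) :=
  [forall j, (j != ord_max) ==> (poly_of c (z j) == 0)].
pose nondet z := [exists c, [exists x, poly_of c x != 0] && hit c z].
have nondet_half : avg (fun z => (nondet z)%:R) <= 1 / 2 :> R.
  apply: le_trans det_large.
  apply: le_trans (_ : avg (fun z : {ffun 'I_N0.+1 -> point p m} => \sum_c
     [exists x, poly_of c x != 0]%:R *
     \prod_j ((j != ord_max) ==> (poly_of c (z j) == 0))%:R) <= _).
    apply: le_avg => z; under eq_bigr do rewrite prod_indic -natrM mulnb.
    exact: le_indic_exists.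
  rewrite avg_sum -card_poly_of// -sum1_card natr_sum mulr_suml; apply: ler_sum => c _.
  rewrite avgZ (avg_prod (fun j x => ((j != ord_max) ==> (poly_of c x == 0))%:R)) mul1r.
  have pos : 0 <= 1 - (2 ^+ d)^-1 :> R.
    by rewrite subr_ge0 invf_le1 ?exprn_gt0// exprn_ege1// ler1n.
  case: existsP => [[x cx]|_]; last by rewrite mul0r exprn_ge0.
  rewrite mul1r big_ord_recr /= eqxx (avg_cst (0 : point p m)) mulr1.
  rewrite -[leRHS](@mulr1) -[X in _ <= _ ^+ X * _](card_ord N0) -prodr_const mulr1.
  apply: ler_prod => j _; apply/andP; split; first exact: avg_ge0.
  have -> : widen_ord (leqnSn N0) j != ord_max by rewrite -val_eqE /= ltn_eqF.
  have := vanish_density R (deg_le_vanish (deg_le_poly_of p_prime c)) cx.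
  rewrite (avg_predC (0 : point p m)) /= => h.
  have : (2 ^+ d)^-1 <= 1 - avg (fun y => (poly_of c y == 0)%:R) :> R.
    by rewrite -div1r ler_pdivrMr ?exprn_gt0// mulrC.
  lra.
apply: le_trans (_ : avg (fun z => 1 - rho + rho * (nondet z)%:R) <= _); last first.
  rewrite avgD (avg_cst [ffun=> 0 : point p m]) avgZ.
  move: (ler_wpM2l rho0 nondet_half); move: (avg _) => X hX; clear - hX; lra.
rewrite (avg_upd ord_max); apply: le_avg => z.
case: (boolP (nondet z)) => [_|det].
  by rewrite mulr1 subrK; apply: (avg_mass (0 : point p m)).
rewrite mulr0 addr0.
(* If some last point allows a consistent [g], the other samples determine it: any other consistent
   [g'] equals [g], so a last point [y] passes only if [F y = g y]. If none does, the average is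
   0. *)
case: (pselect (exists x, consistent d (upd z ord_max x)
    (fun j => F (upd z ord_max x j)))) => [[x [g [dg gE]]]|nex]; last first.
  rewrite /avg big1 ?mul0r ?subr_ge0// => x _.
  by case: asboolP => // cx; case: nex; exists x.
apply: le_trans (_ : avg (fun x => (~~ (F x != g x))%:R) <= _); last first.
  by rewrite (avg_predC (0 : point p m)) lerD2l lerN2; apply: far.
apply: le_avg => y; apply: le_indic => /asboolP[g' [dg' g'E]].
have := g'E ord_max; rewrite upd_eq => <-; rewrite negbK.
have vB : vanish d.+1 (fun u => g' u - g u) by apply: vanishB; apply: deg_le_vanish.
have [c cE] := poly_ofP (vanish_deg_le p_prime vB).
apply: contraR det => ne; apply/existsP; exists c; apply/andP; split.
  by apply/existsP; exists y; rewrite -cE subr_eq0.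
apply/forallP => j; apply/implyP => jm; rewrite -cE subr_eq0.
by have := g'E j; have := gE j; rewrite !upd_neq// => -> ->.
Qed.

End Rounds.

(** * Random affine maps *)

Section RandomAffine.
Context {R : realType} (p m' n : nat) (p_prime : prime p).
Local Notation m := m'.+1.
Local Notation pt := (point p n).

Definition affine_map := (pt * {ffun 'I_m -> pt})%type.

Definition lin (B : {ffun 'I_m -> pt}) (z : point p m) : pt :=
  [ffun k => \sum_i z i * B i k].

Definition affine (a : affine_map) (z : point p m) : pt := a.1 + lin a.2 z.

Lemma linD B z h : lin B (z + h) = lin B z + lin B h.
Proof.
apply/ffunP => k; rewrite !ffunE -big_split; apply: eq_bigr => i _ /=.
by rewrite ffunE mulrDl.
Qed.

Lemma affineD a z h : affine a (z + h) = affine a z + lin a.2 h.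
Proof. by rewrite /affine linD addrA. Qed.

(** A nonempty fibre is a translate of the kernel of the linear part. *)
Lemma affine_fiber (a : affine_map) (y : pt) :
  avg (fun z => (affine a z == y)%:R) <= avg (fun z => (lin a.2 z == 0)%:R) :> R.
Proof.
case: (pickP (fun z => affine a z == y)) => [z0 /eqP <-|no]; last first.
  by rewrite [leLHS]/avg big1 ?mul0r ?avg_ge0// => z _; rewrite no.
rewrite -(avg_shift z0 (fun z => (affine a z == affine a z0)%:R)).
apply: le_avg => z; apply: le_indic.
by rewrite /affine linD addrCA -subr_eq0 addrK.
Qed.

Lemma avg_singleton (T : finType) (P : pred T) :
  (forall x y, P x -> P y -> x = y) -> avg (fun x => (P x)%:R) <= #|T|%:R^-1 :> R.
Proof.
move=> uP; rewrite avg_pred -[leRHS]mul1r ler_wpM2r ?invr_ge0 ?ler0n//.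
rewrite -[leRHS]/(1%:R) ler_nat.
by apply/card_le1_eqP => x y Px Py; apply: uP.
Qed.

(** For [z != 0], resampling a column [i0] with [z i0 != 0] makes [lin B z] uniform, so it is 0 with
    probability [p ^ -n]; the point [z = 0] contributes [p ^ -m]. Degenerate maps are thus accounted
    for and need not be excluded. *)
Lemma avg_ker :
  avg (fun a : affine_map => avg (fun z => (lin a.2 z == 0)%:R)) <=
  (p%:R ^+ m)^-1 + (p%:R ^+ n)^-1 :> R.
Proof.
have card k : #|{: point p k}|%:R = p%:R ^+ k :> R.
  by rewrite card_ffun card_Fp// card_ord natrX.
rewrite exchange_avg -!card.
apply: le_trans (_ : avg (fun z : point p m => (z == 0)%:R + #|{: pt}|%:R^-1) <= _); last first.
  rewrite avgD (avg_cst (0 : point p m)) lerD2r.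
  by apply: avg_singleton => x y /eqP -> /eqP.
apply: le_avg => z.
have [->|nz] := eqVneq z 0.
  apply: le_trans (_ : 1 <= _); last by rewrite lerDl invr_ge0.
  by apply: (avg_mass ((0, [ffun=> 0]) : affine_map)).
rewrite add0r.
have [i0 zi0] : exists i, z i != 0.
  apply/existsP; apply: contraR nz; rewrite negb_exists => /forallP h.
  by apply/eqP/ffunP => i; rewrite ffunE; apply/eqP/negPn.
rewrite avg_pair /= (avg_cst (0 : pt)) (avg_upd i0).
apply: (avg_le ([ffun=> 0] : {ffun 'I_m -> pt})) => B; apply: avg_singleton => u v /eqP hu /eqP hv.
apply/ffunP => k; apply: (mulfI zi0).
move/ffunP/(_ k): hu; move/ffunP/(_ k): hv.
rewrite !ffunE !(bigD1 i0 (P := predT))//= !upd_eq => hv hu.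
have e : \sum_(i | i != i0) z i * upd B i0 v i k = \sum_(i | i != i0) z i * upd B i0 u i k.
  by apply: eq_bigr => i ni; rewrite !upd_neq.
by apply: (addIr (\sum_(i | i != i0) z i * upd B i0 u i k)); rewrite hu -e hv.
Qed.

Lemma avg_rows k (Phi : seq pt -> R) : (k <= m)%N ->
  avg (fun B : {ffun 'I_m -> pt} => Phi [seq B (inord i) | i <- iota 0 k]) = iavg k Phi.
Proof.
elim: k Phi => [|k IH] Phi km.
  by rewrite /= (avg_cst ([ffun=> 0] : {ffun 'I_m -> pt})).
rewrite iavg_rcons -IH ?(ltnW km)// (avg_upd (inord k)).
apply: eq_avg => B; apply: eq_avg => v; congr (Phi _).
have -> : iota 0 k.+1 = rcons (iota 0 k) k by rewrite -addn1 iotaD cats1.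
rewrite map_rcons upd_eq; congr (rcons _ _).
apply/eq_in_map => i; rewrite mem_iota add0n /= => ik.
apply: upd_neq; apply/eqP => /(congr1 (@nat_of_ord _)).
by rewrite !inordK ?(ltn_trans ik)// => e; move: ik; rewrite e ltnn.
Qed.

Definition axis (i : nat) : point p m := [ffun j : 'I_m => ((j : nat) == i)%:R].

Lemma lin_axis B i : (i < m)%N -> lin B (axis i) = B (inord i).
Proof.
move=> im; apply/ffunP => k; rewrite ffunE (bigD1 (inord i))//= ffunE inordK// eqxx mul1r.
rewrite big1 ?addr0// => j ne; rewrite ffunE -[X in _ == X](inordK im).
by rewrite val_eqE (negPf ne) mul0r.
Qed.

(** The image of the axis-parallel cube at any fixed [v] is a uniformly random cube: the translation
    makes its base point uniform, and its directions are independent columns. *)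
Lemma avg_affine_diffs k (f : pt -> 'F_p) (v : point p m) : (k <= m)%N ->
  avg (fun a : affine_map =>
    (diffs [seq axis i | i <- iota 0 k] (f \o affine a) v != 0)%:R) =
  avg (fun x => iavg k (fun hs => (diffs hs f x != 0)%:R)) :> R.
Proof.
move=> km; rewrite avg_pair exchange_avg avg_iavg -avg_rows//.
apply: eq_avg => B; rewrite -(avg_shift (lin B v)); apply: eq_avg => b.
rewrite (diffs_affine _ _ _ (affineD (b, B))) /= -map_comp.
congr ((diffs _ f _ != 0)%:R); apply/eq_in_map => i; rewrite mem_iota add0n /= => ik.
by rewrite lin_axis// (leq_trans ik).
Qed.

(** The bound of [consistent_one_extra] is linear in [rho], so only the average of [rho a] matters,
    not how often a pullback is far. The constant is [1 / 2] from that bound, [1 / 2 ^ d.+1] from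
    differences to distance, and [1 / 4 ^ d.+2] from the derivative test: in total
    [1 / 8 ^ d.+2]. *)
Lemma affine_round d N0 (delta : R) (f : pt -> 'F_p) :
  (d < m)%N -> delta <= 1 -> far_from_deg d delta f ->
  (p ^ #|{: low_exp p m d}|)%:R * (1 - (2 ^+ d)^-1) ^+ N0 <= 1 / 2 :> R ->
  avg (fun s : affine_map * {ffun 'I_N0.+1 -> point p m} =>
    (`[< consistent d s.2 (fun j => f (affine s.1 (s.2 j))) >])%:R)
  <= 1 - delta / 8 ^+ d.+2.
Proof.
move=> dm delta1 far det_large; rewrite avg_pair /=.
pose err a v := diffs [seq axis i | i <- iota 0 d.+1] (f \o affine a) v != 0.
pose rho a : R := (2 ^+ d.+1)^-1 * avg (fun v => (err a v)%:R).
have p2 : 0 < 2 ^+ d.+1 :> R by rewrite exprn_gt0.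
have rho0 a : 0 <= rho a by rewrite mulr_ge0 ?avg_ge0// invr_ge0 ltW.
apply: le_trans (_ : avg (fun a => 1 + - (1 / 2) * rho a) <= _).
  apply: le_avg => a.
  suff far_a g : deg_le d g -> rho a <= avg (fun x => ((f \o affine a) x != g x)%:R).
    apply: le_trans (consistent_one_extra p_prime (rho0 a) det_large far_a) _.
    by rewrite mulNr div1r [_^-1 * _]mulrC.
  move=> dg; rewrite /rho ler_pdivrMl//.
  apply: le_trans (_ : avg (fun v => (diffs [seq axis i | i <- iota 0 d.+1]
     (fun x => (f \o affine a) x - g x) v != 0)%:R) <= _).
    apply: le_avg => v; rewrite diffsB (deg_le_vanish dg) ?subr0//.
    by rewrite size_map size_iota.
  apply: le_trans (avg_diffs_neq0 _ _) _; rewrite size_map size_iota.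
  by rewrite ler_wpM2l ?(ltW p2)//; apply: le_avg => x; rewrite subr_eq0.
rewrite avgD (avg_cst ((0, [ffun=> 0]) : affine_map)) !avgZ exchange_avg.
under eq_avg do rewrite avg_affine_diffs//.
rewrite (avg_cst (0 : point p m)).
have := derivative_test p_prime delta1 far.
set eta := avg _ => h.
have e8 : 8 ^+ d.+2 = 4 ^+ d.+2 * 2 ^+ d.+2 :> R by rewrite -exprMn; congr (_ ^+ _); ring.
have p4 : 0 < 4 ^+ d.+2 :> R by rewrite exprn_gt0.
rewrite lerD2l mulNr lerN2 mulrA ler_pdivrMr ?exprn_gt0// e8.
apply: le_trans h _; rewrite le_eqVlt; apply/orP; left; apply/eqP.
by rewrite [2 ^+ d.+2]exprS; field; rewrite gt_eqF.
Qed.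

End RandomAffine.

(** * Choice of parameters *)

Section Bernoulli.
Context {R : realType}.
Implicit Type x : R.

Lemma bernoulli_lower x c : 0 <= x <= 1 -> 1 - c%:R * x <= (1 - x) ^+ c.
Proof.
move=> /andP[x0 x1]; elim: c => [|c IH]; first by rewrite mul0r subr0.
rewrite exprS; apply: le_trans (ler_wpM2l _ IH); last by lra.
rewrite -natr1; have : 0 <= c%:R * (x * x) by rewrite mulr_ge0// mulr_ge0.
by set y := c%:R; nra.
Qed.

Lemma bernoulli_upper x c : 0 <= x <= 1 -> (1 - x) ^+ c * (1 + c%:R * x) <= 1.
Proof.
move=> /andP[x0 x1]; elim: c => [|c IH]; first by rewrite mul0r addr0 mulr1.
apply: le_trans IH; rewrite exprSr -mulrA ler_wpM2l ?exprn_ge0//; first by lra.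
rewrite -natr1; have : 0 <= c%:R * (x * x) by rewrite mulr_ge0// mulr_ge0.
by set y := c%:R; nra.
Qed.

Lemma half_pow x c : 0 <= x <= 1 -> 1 <= c%:R * x -> (1 - x) ^+ c <= 1 / 2.
Proof.
move=> x01 cx; have h := bernoulli_upper c x01.
have : 0 <= (1 - x) ^+ c by rewrite exprn_ge0//; case/andP: x01; lra.
set y := _ ^+ c in h *; set z := c%:R * x in h cx; nra.
Qed.

Lemma half_powM x c k : 0 <= x <= 1 -> 1 <= c%:R * x ->
  (1 - x) ^+ (c * k) <= (2 ^+ k)^-1.
Proof.
move=> x01 cx; rewrite exprM -exprVn; apply: lerXn2r; rewrite ?nnegrE ?invr_ge0//.
  by rewrite exprn_ge0//; case/andP: x01; lra.
by rewrite -div1r half_pow.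
Qed.

End Bernoulli.

Lemma low_exp_poly (R : realType) p m d :
  #|{: low_exp p m d}|%:R <= 2 ^+ d.+1 * m.+1%:R ^+ d :> R.
Proof.
(* With this [x], Bernoulli's inequality keeps [(1 - x) ^+ m] above 1/2. *)
pose x : R := (2 * m.+1%:R)^-1.
have m0 : 0 < 2 * m.+1%:R :> R by rewrite mulr_gt0.
have x01 : 0 <= x <= 1.
  rewrite invr_ge0 (ltW m0) invf_le1//.
  by rewrite -natrM ler1n muln_gt0.
have hx : 1 / 2 <= (1 - x) ^+ m.
  apply: le_trans (bernoulli_lower m x01).
  suff : m%:R * x <= 1 / 2 by lra.
  rewrite /x ler_pdivrMr//.
  have -> : 1 / 2 * (2 * m.+1%:R) = m.+1%:R :> R by field.
  by rewrite ler_nat leqnSn.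
have := low_exp_bound p m d x01.
set D := _%:R => h.
have : D * x ^+ d * (1 / 2) <= 1.
  by apply: le_trans h; rewrite ler_wpM2l// mulr_ge0// exprn_ge0//; case/andP: x01.
rewrite /x exprVn mulrAC ler_pdivrMr ?exprn_gt0// mul1r exprMn exprS -mulrA => h'.
by move: h'; set y := 2 ^+ d * _; lra.
Qed.

Lemma leq_expn2r e a b : (a <= b)%N -> (a ^ e <= b ^ e)%N.
Proof. by case: e => // e; rewrite leq_exp2r. Qed.

(** With [b = a %/ e.+1], [2 ^ a] contains [e.+1] factors [2 ^ b]: one absorbs the constant, the
    others one factor [b.+1] each. *)
Lemma poly_le_exp (K e : nat) :
  exists a0, forall a, (a0 <= a)%N -> (K * (2 * a + 2) ^ e <= 2 ^ a)%N.
Proof.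
pose b0 := (K * (2 * e.+1) ^ e)%N; exists (e.+1 * b0)%N => a ha.
pose b := (a %/ e.+1)%N.
have b0b : (b0 <= b)%N by rewrite leq_divRL// mulnC.
have ab : (2 * a + 2 <= 2 * e.+1 * b.+1)%N.
  have := ltn_ceil a (ltn0Sn e); rewrite -/b mulnC => h.
  by rewrite -mulnA -[X in (_ + X)%N]muln1 -mulnDr leq_mul2l addn1.
have bb : (b.+1 <= 2 ^ b)%N by exact: ltn_expl.
apply: (@leq_trans (K * (2 * e.+1 * b.+1) ^ e)); first by rewrite leq_mul2l leq_expn2r ?orbT.
rewrite expnMn mulnA -/b0.
apply: (@leq_trans (2 ^ b * (2 ^ b) ^ e)).
  apply: leq_mul; first by apply: leq_trans b0b (leq_trans (leqnSn b) bb).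
  exact: leq_expn2r.
by rewrite -expnM -expnD leq_exp2l// -mulnS leq_divM.
Qed.

(** * The two testers with explicit parameters *)

Definition resilient_tester (R : realType) (p n d t : nat) (delta : R) (q : nat) :=
  exists (Rnd : finType) (qry : Rnd -> seq 'F_p -> point p n)
    (dec : Rnd -> seq 'F_p -> bool),
    forall (f : point p n -> 'F_p) (adv : seq (point p n) -> point p n -> 'F_p),
      online_adversary t f adv ->
      (deg_le d f -> 2 / 3 <= accept_prob R q qry dec adv) /\
      (far_from_deg d delta f -> 2 / 3 <= 1 - accept_prob R q qry dec adv).

(** Each [c] rounds halve the acceptance probability, and [3 * c] rounds leave 1/8, below 1/6.
    Likewise each [2 ^ d] samples halve the chance of missing the support of a nonzero polynomial;
    with [D] monomials, [2 ^ (p * D)] exceeds the number [p ^ D] of polynomials, and the extra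
    halving leaves 1/2. *)
Lemma affine_tester (R : realType) (p n m' d t c N0 : nat) (delta : R) :
  prime p -> (d <= m')%N -> 0 < delta <= 1 -> (0 < c)%N ->
  1 <= c%:R * (delta / 8 ^+ d.+2) ->
  N0 = (2 ^ d * (p * #|{: low_exp p m'.+1 d}|).+1)%N ->
  t%:R * (3 * c * N0.+1)%:R ^+ 2 * ((p%:R ^+ m'.+1)^-1 + (p%:R ^+ n)^-1) <= 1 / 6 :> R ->
  resilient_tester p n d t delta (3 * c * N0.+1).
Proof.
move=> p_prime dm /andP[delta0 delta1] c0 cd N0E.
have -> : (3 * c = (3 * c).-1.+1)%N by rewrite prednK// muln_gt0.
move=> small.
pose a0 : affine_map p m' n := (0, [ffun=> 0]).
have fib := @affine_fiber R p m' n.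
exists (@seed p m'.+1 (3 * c).-1 N0 (affine_map p m' n)).
exists (@tester_query p n m'.+1 (3 * c).-1 N0 _ (@affine p m' n)).
exists (@tester_decision p m'.+1 d (3 * c).-1 N0 _).
move=> f adv adv_ok; split=> [deg|far].
  apply: (tester_complete a0 adv_ok fib (avg_ker m' n p_prime) small) => a.
  exact: (@deg_le_affine p p_prime _ _ _ (affine a) (lin a.2) f (affineD a) deg).
apply: (tester_sound a0 adv_ok fib (avg_ker m' n p_prime) small).
rewrite prednK ?muln_gt0//.
have d8 : 0 <= delta / 8 ^+ d.+2 <= 1.
  rewrite divr_ge0 ?exprn_ge0 ?(ltW delta0)//= ler_pdivrMr ?exprn_gt0// mul1r.
  by apply: le_trans delta1 _; rewrite exprn_ege1// ler1n.
have det : (p ^ #|{: low_exp p m'.+1 d}|)%:R * (1 - (2 ^+ d)^-1) ^+ N0 <= 1 / 2 :> R.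
  have d2 : 0 < 2 ^+ d :> R by rewrite exprn_gt0.
  have : (1 - (2 ^+ d)^-1) ^+ N0 <= (2 ^+ (p * #|{: low_exp p m'.+1 d}|).+1)^-1 :> R.
    rewrite N0E; apply: half_powM; last by rewrite natrX divff// gt_eqF.
    by rewrite invr_ge0 (ltW d2) invf_le1//= exprn_ege1// ler1n.
  move/(ler_wpM2l (ler0n R (p ^ #|{: low_exp p m'.+1 d}|)))/le_trans; apply.
  rewrite exprS invfM mulrCA -[leRHS]mulr1 div1r ler_wpM2l ?invr_ge0//.
  rewrite ler_pdivrMr ?exprn_gt0// mul1r -natrX ler_nat expnM.
  by apply: leq_expn2r; apply: ltnW; apply: ltn_expl.
apply: le_trans (_ : (1 - delta / 8 ^+ d.+2) ^+ (c * 3) <= _).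
  rewrite mulnC; apply: lerXn2r; rewrite ?nnegrE; first exact: avg_ge0.
    by rewrite subr_ge0; case/andP: d8.
  exact: affine_round.
by apply: le_trans (half_powM 3 d8 cd) _; clear; lra.
Qed.

(** A single round with the identity map. A bound [p <= 2 ^ l] replaces the crude [p <= 2 ^ p] of
    [affine_tester]: for small [n], a factor [p] in the query count could not be afforded against
    [p ^ n]. *)
Lemma point_tester (R : realType) (p n d t c l N : nat) (delta : R) :
  prime p -> 0 < delta <= 1 -> (0 < c)%N -> 1 <= c%:R * delta -> (p <= 2 ^ l)%N ->
  N = (c * (l * #|{: low_exp p n d}| + 3))%N ->
  t%:R * N%:R ^+ 2 * (p%:R ^+ n)^-1 <= 1 / 6 :> R ->
  resilient_tester p n d t delta N.
Proof.
move=> p_prime /andP[delta0 delta1] c0 cd pl NE small.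
have N0 : (0 < N)%N by rewrite NE muln_gt0 c0 addnS.
have NE' : (N = 1 * N.-1.+1)%N by rewrite mul1n prednK.
rewrite NE' in small *.
pose phi (u : unit) (z : point p n) := z.
have fib u y : avg (fun z => (phi u z == y)%:R) <= (p%:R ^+ n)^-1 :> R.
  rewrite -natrX -[X in (X ^ _)%N](card_Fp p_prime) -[X in (_ ^ X)%N]card_ord -card_ffun.
  by apply: avg_singleton => x x' /eqP; rewrite /phi => -> /eqP.
have wtau : avg (fun _ : unit => (p%:R ^+ n)^-1) <= (p%:R ^+ n)^-1 :> R by rewrite (avg_cst tt).
exists (@seed p n 0 N.-1 unit), (@tester_query p n n 0 N.-1 unit phi).
exists (@tester_decision p n d 0 N.-1 unit).
move=> f adv adv_ok; split=> [deg|far].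
  exact: (tester_complete tt adv_ok fib wtau small).
apply: (tester_sound tt adv_ok fib wtau small).
rewrite expr1 avg_pair /= /phi (avg_cst tt).
have far_avg g : deg_le d g -> delta <= avg (fun x => (f x != g x)%:R).
  by move/far; rewrite /dist -avg_pred.
apply: le_trans (consistent_union_bound p_prime _ far_avg) _.
have d01 : 0 <= delta <= 1 by rewrite (ltW delta0).
rewrite prednK// NE.
have := half_powM (l * #|{: low_exp p n d}| + 3) d01 cd.
move/(ler_wpM2l (ler0n R (p ^ #|{: low_exp p n d}|)))/le_trans; apply.
rewrite exprD invfM mulrA.
apply: (@le_trans _ _ (1 * (2 ^+ 3)^-1)); last by clear; lra.
rewrite ler_wpM2r ?invr_ge0 ?exprn_ge0// ler_pdivrMr ?exprn_gt0// mul1r -natrX ler_nat expnM.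
exact: leq_expn2r.
Qed.

(** * Query counts and corruption bounds for both testers *)

Lemma low_exp_root (R : realType) p n d (Q : R) : prime p ->
  Q ^+ 20 = p%:R ^+ n -> 16 ^+ d <= Q -> #|{: low_exp p n d}|%:R <= Q ^+ 3.
Proof.
move=> p_prime Q20 Q16.
have Q0 : 0 <= Q by apply: le_trans Q16; rewrite exprn_ge0.
have x01 : 0 <= (1 / 16 : R) <= 1 by apply/andP; split; lra.
have := low_exp_bound p n d x01.
have -> : 1 - 1 / 16 = 15 / 16 :> R by lra.
set D := _%:R => h.
(* Since [(16 / 15) ^ 10 <= 2 <= p], the power [(16 / 15) ^ n] is at most [p ^ (n / 10) = Q ^ 2]. *)
have hn : (16 / 15) ^+ n <= Q ^+ 2.
  rewrite -(@ler_pXn2r _ 10)// ?nnegrE ?exprn_ge0//; last by lra.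
  rewrite -!exprM mulnC exprM Q20; apply: lerXn2r; rewrite ?nnegrE ?exprn_ge0//; first by lra.
  apply: (@le_trans _ _ 2); first by lra.
  by rewrite ler_nat prime_gt1.
have -> : D = (D * (1 / 16) ^+ d * (15 / 16) ^+ n) * (16 ^+ d * (16 / 15) ^+ n).
  have e1 : (1 / 16) ^+ d * 16 ^+ d = 1 :> R.
    by rewrite -exprMn (_ : 1 / 16 * 16 = 1) ?expr1n//; field.
  have e2 : (15 / 16) ^+ n * (16 / 15) ^+ n = 1 :> R.
    by rewrite -exprMn (_ : 15 / 16 * (16 / 15) = 1) ?expr1n//; field.
  by rewrite mulrACA -(mulrA D) e1 e2 !mulr1.
apply: le_trans (_ : 1 * (16 ^+ d * (16 / 15) ^+ n) <= _).
  by rewrite ler_wpM2r// mulr_ge0// exprn_ge0//; lra.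
rewrite mul1r exprS; apply: ler_pM => //; rewrite exprn_ge0//; lra.
Qed.

(** Writing [l] for the logarithm and [j = l.-1 %/ 20], the bound [2 ^ l.-1 < p] gives [2 ^ j <= Q],
    while [l <= 20 * j.+1 <= 20 * 2 ^ j]. *)
Lemma up_log_root (R : realType) p n (Q : R) : prime p -> (0 < n)%N -> 0 <= Q ->
  Q ^+ 20 = p%:R ^+ n -> (up_log 2 p)%:R <= 20 * Q.
Proof.
move=> p_prime n0 Q0 Q20; have p1 := prime_gt1 p_prime.
pose l := up_log 2 p; pose j := (l.-1 %/ 20)%N.
have l0 : (0 < l)%N by rewrite up_log_gt0 p1.
have jQ : 2 ^+ j <= Q.
  rewrite -(@ler_pXn2r _ 20)// ?nnegrE ?exprn_ge0// Q20 -exprM.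
  apply: (@le_trans _ _ p%:R); last by rewrite ler_eXnr// ler1n prime_gt0.
  rewrite -natrX ler_nat; apply: leq_trans (ltnW (@up_log_gtn 2 p isT p1)).
  by rewrite leq_exp2l// leq_divM.
have lj : (l <= 20 * j.+1)%N.
  by rewrite -(prednK l0) mulnC; apply: ltn_ceil.
apply: le_trans (_ : (20 * j.+1)%:R <= _); first by rewrite ler_nat.
rewrite natrM ler_wpM2l//; apply: le_trans jQ.
by rewrite -natrX ler_nat ltn_expl.
Qed.

(** Everything is measured by [Q = P ^ d], where [Q ^ 20 = p ^ n]. As [t >= 1], the hypothesis gives
    [30 <= P * delta], hence [c <= Q / 15]; the query count is then at most [2 * Q ^ 5] and
    [t <= Q / 30], so the numerator is of order [Q ^ 11]. *)
Lemma point_corruption (R : realType) (p n d t c : nat) (delta : R) :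
  prime p -> (0 < d)%N -> (0 < n)%N -> (0 < t)%N -> 0 < delta <= 1 ->
  t%:R <= delta / 30 * ((p%:R : R) `^ (n%:R / (20 * d)%:R)) ->
  c%:R <= 2 / delta ->
  t%:R * (c * (up_log 2 p * #|{: low_exp p n d}| + 3))%:R ^+ 2 * (p%:R ^+ n)^-1
  <= 1 / 6 :> R.
Proof.
move=> p_prime d0 n0 t0 /andP[delta0 delta1]; set P := _ `^ _ => tP cd.
have P0 : 0 <= P by apply: powR_ge0.
have P20 : (P ^+ d) ^+ 20 = p%:R ^+ n.
  rewrite -exprM mulnC -powR_mulrn// -powRrM divfK ?powR_mulrn//.
  by rewrite pnatr_eq0 muln_eq0 -lt0n d0.
set Q := P ^+ d in P20.
have t1 : 1 <= t%:R :> R by rewrite ler1n.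
have Pd : 30 * t%:R <= P * delta by move: tP; set T := t%:R; lra.
have P30 : 30 * t%:R <= P by apply: le_trans Pd _; rewrite ler_piMr.
have PQ : P <= Q by rewrite /Q ler_eXnr//; lra.
have Q30 : 30 <= Q by lra.
have Q0 : 0 <= Q by lra.
have Q1 k : 1 <= Q ^+ k by rewrite exprn_ege1//; lra.
have hD : #|{: low_exp p n d}|%:R <= Q ^+ 3.
  apply: low_exp_root p_prime P20 _; rewrite /Q; apply: lerXn2r; rewrite ?nnegrE//.
  by lra.
have hl := up_log_root p_prime n0 Q0 P20.
have hc : c%:R <= Q / 15.
  apply: le_trans cd _; rewrite ler_pdivrMr//.
  suff : P * delta <= Q * delta by lra.
  by rewrite ler_wpM2r// ltW.
have hN : (c * (up_log 2 p * #|{: low_exp p n d}| + 3))%:R <= 2 * Q ^+ 5.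
  rewrite natrM; apply: le_trans (_ : Q / 15 * (21 * Q ^+ 4) <= _).
    apply: ler_pM => //; rewrite natrD natrM.
    have : (up_log 2 p)%:R * #|{: low_exp p n d}|%:R <= 20 * Q * Q ^+ 3 by apply: ler_pM.
    rewrite -mulrA -exprS; have := ler_wpM2r Q0 (Q1 3%N).
    rewrite mul1r -exprSr.
    by set x := _ * _; set y := Q ^+ 4 => h1 h2; lra.
  have -> : Q / 15 * (21 * Q ^+ 4) = 21 / 15 * Q ^+ 5 by rewrite exprS; field.
  by rewrite ler_wpM2r ?exprn_ge0//; lra.
rewrite -P20 ler_pdivrMr ?exprn_gt0//; last by lra.
apply: (@le_trans _ _ (Q / 30 * (2 * Q ^+ 5) ^+ 2)).
  apply: ler_pM; rewrite ?exprn_ge0//; first by lra.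
  by apply: lerXn2r; rewrite ?nnegrE// mulr_ge0// exprn_ge0.
have -> : Q / 30 * (2 * Q ^+ 5) ^+ 2 = 2 / 15 * Q ^+ 11 by field.
have -> : Q ^+ 20 = Q ^+ 9 * Q ^+ 11 by rewrite -exprD.
rewrite [leRHS]mulrA ler_wpM2r ?exprn_ge0//.
by have := Q1 9%N; lra.
Qed.

Lemma expR1_le4 (R : realType) : expR 1 <= 4 :> R.
Proof.
have h : 1 / 2 <= expR (- (1 / 2)) :> R.
  by apply: le_trans (expR_ge1Dx _); lra.
have -> : 1 = 1 / 2 + 1 / 2 :> R by lra.
rewrite expRD.
have := expR_gt0 (1 / 2 : R); have := expRxMexpNx_1 (1 / 2 : R).
set x := expR (1 / 2) => e x0.
have : x <= 2 by move: h e; set y := expR _; nra.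
nra.
Qed.

Lemma ceil_bounds (R : realType) (x : R) : 0 <= x ->
  x <= (Num.truncn x).+1%:R <= x + 1.
Proof.
move=> x0; rewrite ltW ?truncnS_gt//= -natr1 lerD2r truncn_le.
by [].
Qed.

Lemma point_queries (R : realType) (p n d c : nat) (delta X : R) :
  0 < delta -> c%:R <= 2 / delta -> n.+1%:R <= X ->
  (c * (up_log 2 p * #|{: low_exp p n d}| + 3))%:R <=
  (2 * (up_log 2 p * 2 ^ d.+1 + 3))%:R * X ^+ d / delta.
Proof.
move=> delta0 c2 nX; set L := up_log 2 p.
have -> : (2 * (L * 2 ^ d.+1 + 3))%:R * X ^+ d / delta =
    2 / delta * ((L * 2 ^ d.+1 + 3)%:R * X ^+ d).
  by rewrite natrM; field; rewrite gt_eqF.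
rewrite natrM; apply: ler_pM => //.
apply: (@le_trans _ _ ((L * 2 ^ d.+1 + 3)%:R * n.+1%:R ^+ d)); last first.
  rewrite ler_wpM2l//; apply: lerXn2r; rewrite ?nnegrE//.
  by apply: le_trans nX.
rewrite !natrD mulrDl lerD//.
  by rewrite !natrM -mulrA ler_wpM2l// natrX; apply: low_exp_poly.
by rewrite ler_peMr// exprn_ege1// ler1n.
Qed.

(** The product of [6 * 8 ^ d.+2], from [3 * c], and [3 * p * 4 ^ d.+1], from the samples per
    round. *)
Definition affine_const (p d : nat) : nat := (18 * p * 8 ^ d.+2 * 4 ^ d.+1)%N.

Lemma affine_queries (R : realType) (p m d c N0 : nat) (delta : R) :
  prime p -> 0 < delta -> c%:R <= 2 * (8 ^+ d.+2 / delta) ->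
  N0 = (2 ^ d * (p * #|{: low_exp p m d}|).+1)%N ->
  (3 * c * N0.+1)%:R <= (affine_const p d)%:R * m.+1%:R ^+ d / delta :> R.
Proof.
move=> p_prime delta0 c2 ->.
set N1 := (_ * _).+1.
have N1le : N1%:R <= 3 * p%:R * 4 ^+ d.+1 * m.+1%:R ^+ d :> R.
  have := low_exp_poly R p m d.
  have : 1 <= m.+1%:R ^+ d :> R by rewrite exprn_ege1// ler1n.
  have e4 : 4 ^+ d.+1 = 4 * (2 ^+ d * 2 ^+ d) :> R.
    by rewrite exprS -exprMn; congr (_ * _ ^+ _); ring.
  have : 1 <= 2 ^+ d :> R by rewrite exprn_ege1// ler1n.
  have : 1 <= p%:R :> R by rewrite ler1n prime_gt0.
  have -> : N1%:R = 2 ^+ d * (p%:R * #|{: low_exp p m d}|%:R + 1) + 1 :> R.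
    by rewrite -(natrM R p) natr1 -natrX -natrM natr1.
  rewrite e4 exprS.
  move: #|_|%:R (m.+1%:R ^+ d) (2 ^+ d) p%:R => D X Y P; clear => P1 Y1 X1 hD.
  have h1 : Y * (P * D) <= Y * (P * (2 * Y * X)).
    by rewrite ler_wpM2l ?ler_wpM2l//; lra.
  have h2 : 1 <= Y * X by rewrite -[leLHS]mulr1 ler_pM.
  have h3 : Y * X <= P * Y * (Y * X).
    rewrite ler_peMl//; first by lra.
    by rewrite -[leLHS]mulr1 ler_pM.
  have h4 : Y <= Y * X by rewrite ler_peMr//; lra.
  have -> : 3 * P * (4 * (Y * Y)) * X = 12 * (P * Y * (Y * X)) by ring.
  have e1 : Y * (P * (2 * Y * X)) = 2 * (P * Y * (Y * X)) by ring.
  by rewrite mulrDr mulr1; lra.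
rewrite natrM; apply: (@le_trans _ _ (6 * 8 ^+ d.+2 / delta *
    (3 * p%:R * 4 ^+ d.+1 * m.+1%:R ^+ d))).
  apply: ler_pM => //; rewrite natrM -mulrA.
  by move: c2; move: (_ / delta) c%:R => x y; clear; lra.
rewrite le_eqVlt; apply/orP; left; apply/eqP.
rewrite /affine_const (natrM _ _ (4 ^ d.+1)) (natrM _ _ (8 ^ d.+2)) (natrM _ 18 p) !natrX.
move: (8 ^+ d.+2) (4 ^+ d.+1) (m.+1%:R ^+ d) p%:R => x y z w.
by field; rewrite gt_eqF.
Qed.

(** The sampled dimension [2 * a + 1] splits [p ^ m] into two factors [2 ^ a]: one pays for the
    polynomial factor of [q ^ 2], the other for [(t / delta) ^ 2 <= 16 ^ j]. The remaining 2 covers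
    the two kernel terms. *)
Lemma affine_corruption (R : realType) (p n d t K a j q : nat) (delta : R) :
  prime p -> (0 < t)%N -> 0 < delta -> ((2 * a).+1 <= n)%N -> (4 * j <= a)%N ->
  (6 * K ^ 2 * (2 * a + 2) ^ (2 * d) <= 2 ^ a)%N ->
  t%:R / delta <= 4 ^+ j ->
  q%:R <= K%:R * (2 * a).+2%:R ^+ d / delta ->
  t%:R * q%:R ^+ 2 * ((p%:R ^+ (2 * a).+1)^-1 + (p%:R ^+ n)^-1) <= 1 / 6 :> R.
Proof.
move=> p_prime t0 delta0 mn ja hK td qK.
have t1 : 1 <= t%:R :> R by rewrite ler1n.
have p2 k : 2 ^+ k <= p%:R ^+ k :> R.
  by apply: lerXn2r; rewrite ?nnegrE// ler_nat prime_gt1.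
have inv2 : (p%:R ^+ (2 * a).+1)^-1 + (p%:R ^+ n)^-1 <= 2 * (2 ^+ (2 * a).+1)^-1 :> R.
  rewrite [leRHS]mulr_natl mulr2n.
  apply: lerD; rewrite lef_pV2 ?posrE ?exprn_gt0 ?ltr0n ?prime_gt0//.
  by apply: le_trans (p2 n); apply: ler_weXn2l => //; rewrite ler1n.
set A := K%:R ^+ 2 * (2 * a).+2%:R ^+ (2 * d) : R.
have tq : t%:R * q%:R ^+ 2 <= A * 16 ^+ j :> R.
  apply: (@le_trans _ _ (t%:R ^+ 2 * (K%:R * (2 * a).+2%:R ^+ d / delta) ^+ 2)).
    apply: ler_pM; rewrite ?exprn_ge0//; first by rewrite ler_eXnr.
    by apply: lerXn2r; rewrite ?nnegrE//; apply: le_trans qK.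
  have -> : t%:R ^+ 2 * (K%:R * (2 * a).+2%:R ^+ d / delta) ^+ 2 =
    A * (t%:R / delta) ^+ 2 :> R.
    rewrite /A (mulnC 2 d) exprM; move: (_ ^+ d) t%:R K%:R => x y z.
    by field; rewrite gt_eqF.
  rewrite ler_wpM2l ?mulr_ge0 ?exprn_ge0//.
  have -> : 16 ^+ j = (4 ^+ j) ^+ 2 :> R.
    by rewrite -!exprM mulnC exprM; congr (_ ^+ _); ring.
  apply: lerXn2r; rewrite ?nnegrE ?exprn_ge0 ?divr_ge0//; exact: ltW.
have h1 : 6 * A <= 2 ^+ a :> R.
  have e : (2 * a).+2 = (2 * a + 2)%N by rewrite addn2.
  by rewrite /A e mulrA -!natrX -!natrM ler_nat.
have h2 : 16 ^+ j <= 2 ^+ a :> R.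
  have -> : 16 = 2 ^+ 4 :> R by ring.
  by rewrite -exprM; apply: ler_weXn2l; rewrite // ler1n.
have A0 : 0 <= A by rewrite mulr_ge0// exprn_ge0.
clearbody A.
have fin : 6 * (A * 16 ^+ j * (2 * (2 ^+ (2 * a).+1)^-1)) <= 1 :> R.
  have -> : 2 ^+ (2 * a).+1 = 2 * (2 ^+ a * 2 ^+ a) :> R.
    by rewrite exprS mul2n -addnn exprD.
  have -> : 2 / (2 * (2 ^+ a * 2 ^+ a)) = (2 ^+ a * 2 ^+ a)^-1 :> R.
    by rewrite invfM mulVKf// pnatr_eq0.
  rewrite !mulrA ler_pdivrMr ?mulr_gt0 ?exprn_gt0// mul1r.
  by apply: ler_pM; rewrite ?mulr_ge0 ?exprn_ge0.
have : t%:R * q%:R ^+ 2 * ((p%:R ^+ (2 * a).+1)^-1 + (p%:R ^+ n)^-1) <=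
    A * 16 ^+ j * (2 * (2 ^+ (2 * a).+1)^-1).
  by apply: ler_pM; rewrite ?mulr_ge0 ?addr_ge0 ?invr_ge0 ?exprn_ge0.
by move: fin; move: (A * _ * _) (t%:R * _ * _) => x y; clear; lra.
Qed.

(** * Choice of the dimension and assembly *)

Lemma le_pow4_ln (R : realType) (x : R) j : 0 < x -> ln x <= j%:R -> x <= 4 ^+ j.
Proof.
move=> x0 xj; rewrite -[leLHS]lnK ?posrE//.
apply: (@le_trans _ _ (expR j%:R)); first by rewrite ler_expR.
rewrite -[j%:R]mulr1 expRM_natl.
by apply: lerXn2r; rewrite ?nnegrE ?expR_ge0// expR1_le4.
Qed.

Lemma resilient_tester_exists (R : realType) (p d : nat) : prime p -> (0 < d)%N ->
  exists C : R, 0 < C /\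
  forall (n : nat) (delta Lam : R) (t : nat),
    (0 < n)%N -> 0 < delta <= 1 -> 1 <= Lam -> ln (t%:R / delta) <= Lam ->
    t%:R <= delta / 30 * ((p%:R : R) `^ (n%:R / (20 * d)%:R)) ->
    exists q, q%:R <= C * Lam ^+ d / delta /\ resilient_tester p n d t delta q.
Proof.
move=> p_prime d0.
have [a0 a0P] := poly_le_exp (6 * affine_const p d ^ 2) (2 * d).
(* The summand [d] provides the [d.+1] axes that the affine tester needs. [W] is chosen so that
   [2 * b + 8 * (Lam + 1) + 2 <= W * Lam] when [Lam >= 1]. *)
pose b := (a0 + d)%N; pose W : R := 2 * b%:R + 18.
pose C1 := affine_const p d; pose C2 := (2 * (up_log 2 p * 2 ^ d.+1 + 3))%N.
have W0 : 0 < W by rewrite ltr_wpDl// mulr_ge0.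
exists ((C1 + C2)%:R * W ^+ d); split.
  by rewrite mulr_gt0 ?exprn_gt0// ltr0n addn_gt0 /C2 addn3 orbT.
move=> n delta Lam t n0 delta01 Lam1 lnLam tP.
have [delta0 delta1] := andP delta01.
have Lam0 : 0 <= Lam by apply: le_trans Lam1.
have qC (K q : nat) : q%:R <= K%:R * (W * Lam) ^+ d / delta -> (K <= C1 + C2)%N ->
    q%:R <= (C1 + C2)%:R * W ^+ d * Lam ^+ d / delta.
  move=> qK KC; apply: le_trans qK _; rewrite ler_wpM2r ?invr_ge0 ?(ltW delta0)//.
  rewrite -[leRHS]mulrA -exprMn ler_wpM2r ?ler_nat// exprn_ge0// mulr_ge0//.
  exact: ltW.
have [Lj jL] := andP (ceil_bounds Lam0).
move: (Num.truncn Lam).+1 Lj jL => j Lj jL.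
pose a := (b + 4 * j)%N.
have aW : (2 * a).+2%:R <= W * Lam.
  rewrite -addn2 natrD natrM natrD natrM /W.
  have : 0 <= b%:R :> R by []; move: b%:R j%:R jL Lam1 => x y; clear; nra.
have delta_inv : 1 <= delta^-1 by rewrite invf_ge1.
(* The case [t = 0] goes to the affine tester for every [n], its corruption bound being trivial; the
   bound for direct sampling relies on [t >= 1]. *)
have [large|] := boolP ((t == 0) || ((2 * a).+1 <= n))%N; last first.
  rewrite negb_or -lt0n -ltnNge => /andP[t0 nm].
  have [|cd dc] := andP (@ceil_bounds R delta^-1 _); first by rewrite invr_ge0 ltW.
  move: (Num.truncn delta^-1).+1 (ltn0Sn (Num.truncn delta^-1)) cd dc => c c0 cd dc.
  have c2 : c%:R <= 2 / delta by move: c%:R delta^-1 dc delta_inv => x y; clear; lra.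
  exists (c * (up_log 2 p * #|{: low_exp p n d}| + 3))%N; split.
    apply: (qC C2); last by rewrite leq_addl.
    apply: point_queries => //; apply: le_trans aW; rewrite ler_nat.
    by apply: leq_trans nm _.
  apply: (@point_tester R p n d t c (up_log 2 p)) => //.
  - by rewrite -ler_pdivrMr// div1r.
  - exact: up_logP.
  - exact: (point_corruption p_prime d0 n0 t0 delta01 tP c2).
have d8 : 1 <= 8 ^+ d.+2 / delta.
  by rewrite -[leLHS]mulr1 ler_pM// exprn_ege1// ler1n.
have [|cd dc] := andP (@ceil_bounds R (8 ^+ d.+2 / delta) _); first by apply: le_trans d8.
move: (Num.truncn (8 ^+ d.+2 / delta)).+1
  (ltn0Sn (Num.truncn (8 ^+ d.+2 / delta))) cd dc => c c0 cd dc.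
have c2 : c%:R <= 2 * (8 ^+ d.+2 / delta).
  by move: c%:R (_ / delta) dc d8 => x y; clear; lra.
pose N0 := (2 ^ d * (p * #|{: low_exp p (2 * a).+1 d}|).+1)%N.
have qK := affine_queries p_prime delta0 c2 (erefl N0).
exists (3 * c * N0.+1)%N; split.
  apply: (qC C1); last by rewrite leq_addr.
  apply: le_trans qK _; rewrite ler_wpM2r ?invr_ge0 ?(ltW delta0)// ler_wpM2l//.
  by apply: lerXn2r; rewrite ?nnegrE ?mulr_ge0// ltW.
apply: (@affine_tester R p n (2 * a) d t c N0) => //.
- by rewrite /a /b; clear; lia.
- by rewrite mulrA ler_pdivlMr ?exprn_gt0// mul1r -ler_pdivrMr.
case: eqP large => [-> _|/eqP]; first by rewrite !mul0r; clear; lra.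
rewrite -lt0n => t0 /= mn.
apply: (affine_corruption p_prime t0 delta0 mn (leq_addl _ _) _ _ qK).
  by apply: a0P; rewrite /a /b -addnA leq_addr.
by apply: le_pow4_ln (le_trans lnLam Lj); rewrite divr_gt0// ltr0n.
Qed.

Theorem theorem5p1 (R : realType) (p d : nat) :
  prime p -> (0 < d)%N ->
  exists C : R, 0 < C /\
  forall (n : nat) (delta : R) (t : nat),
    (0 < n)%N -> 0 < delta <= 1 ->
    t%:R <= delta / 30 * ((p%:R : R) `^ (n%:R / (20 * d)%:R)) ->
    exists (Rnd : finType) (q : nat)
           (qry : Rnd -> seq 'F_p -> point p n) (dec : Rnd -> seq 'F_p -> bool),
      q%:R <= C * (Num.max 1 (ln (t%:R / delta))) ^+ (3 * d + 3) / delta /\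
      forall (f : point p n -> 'F_p) (adv : seq (point p n) -> point p n -> 'F_p),
        online_adversary t f adv ->
        (deg_le d f -> 2 / 3 <= accept_prob R q qry dec adv) /\
        (far_from_deg d delta f -> 2 / 3 <= 1 - accept_prob R q qry dec adv).
Proof.
move=> p_prime d0; have [C [C0 CP]] := resilient_tester_exists R p_prime d0.
exists C; split=> // n delta t n0 delta01 tP.
set Lam := Num.max _ _.
have Lam1 : 1 <= Lam by rewrite le_max lexx.
have lnLam : ln (t%:R / delta) <= Lam by rewrite le_max lexx orbT.
have [q [qC [Rnd [qry [dec ok]]]]] := CP n delta Lam t n0 delta01 Lam1 lnLam tP.
exists Rnd, q, qry, dec; split=> //; apply: le_trans qC _.
have [delta0 _] := andP delta01.
rewrite ler_wpM2r ?invr_ge0 ?(ltW delta0)// ler_wpM2l ?(ltW C0)//.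
(* The construction achieves exponent [d]; as [Lam >= 1], it may be raised to [3 * d + 3]. *)
by apply: ler_weXn2l => //; rewrite -addnA (leq_trans _ (leq_addr _ _))// leq_pmull.
Qed.
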